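(* Let $G^+$ be the positive cone of a totally ordered abelian group $G$ and let $(A,G^+,\alpha,L)$ be a semigroup corner system. For $t\in G^+$ let $$B_t:=\{a\delta_t:a\in A\overline{\alpha}_t(1)\},\qquad B_{-t}:=\{a\delta_{-t}:a\in\overline{\alpha}_t(1)A\},$$ Banach spaces naturally isomorphic to $A\overline{\alpha}_t(1)$ and $\overline{\alpha}_t(1)A$ respectively (the $\delta$'s are formal markers). Define $(a\delta_g)^*:=a^*\delta_{-g}$ and $$a\delta_g\cdot b\delta_h:=\begin{cases}a\alpha_g(b)\delta_{g+h}& g,h\ge0,\\ L_{-g}(ab)\delta_{g+h}& g<0,\ h\ge0,\ g+h\ge0,\\ L_h(ab)\delta_{g+h}& g<0,\ h\ge0,\ g+h<0,\\ a\alpha_{g+h}(b)\delta_{g+h}& h<0,\ g\ge0,\ g+h\ge0,\\ \alpha_{-g-h}(a)b\,\delta_{g+h}& h<0,\ g\ge0,\ g+h<0,\\ \alpha_{-h}(a)b\,\delta_{g+h}& g,h<0.\end{cases}$$ Then the family $\mathcal{B}=\{B_g\}_{g\in G}$ of Banach spaces with these operations forms a Fell bundle over the discrete group $G$.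
   Context: $G^+$ is a subsemigroup of the abelian group $G$ with $G^+\cap(-G^+)=\{0\}$, $G=G^+\cup(-G^+)$, and $g\ge h$ means $g-h\in G^+$. $\mathrm{End}(A)$ is the semigroup of ($*$-)endomorphisms of the $C^*$-algebra $A$ and $\mathrm{Pos}(A)$ the semigroup of positive linear maps on $A$, under composition; homomorphisms of unital semigroups preserve units. A semigroup corner system $(A,G^+,\alpha,L)$ consists of semigroup homomorphisms $\alpha:G^+\to\mathrm{End}(A)$, $L:G^+\to\mathrm{Pos}(A)$ such that for every $t\in G^+$: $L_t(\alpha_t(a)b)=aL_t(b)$ for all $a,b\in A$, and $\alpha_t\circ L_t$ is a conditional expectation onto a hereditary $C^*$-subalgebra $\alpha_t(A)$ of $A$. Equivalently, given the first condition, $\alpha_t$ extends to a strictly continuous map $\overline{\alpha}_t:M(A)\to M(A)$ and $\alpha_t(L_t(a))=\overline{\alpha}_t(1)a\overline{\alpha}_t(1)$ for all $a\in A$, where $1$ is the unit of the multiplier algebra $M(A)$. A Fell bundle over $G$ is a family $\{B_g\}_{g\in G}$ of Banach spaces with bilinear associative multiplications $B_g\times B_h\to B_{gh}$ and conjugate-linear isometric involutions $B_g\to B_{g^{-1}}$, with $(bc)^*=c^*b^*$, $b^{**}=b$, $\|bc\|\le\|b\|\|c\|$, $\|b^*b\|=\|b\|^2$, and $b^*b$ positive in the $C^*$-algebra $B_e$, for all $b\in B_g$, $c\in B_h$, $g,h\in G$. *)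

(* Defs.v *)
From HB Require Import structures.
From mathcomp Require Import all_boot all_order all_algebra.
From mathcomp Require Import complex.
From mathcomp Require Import all_classical all_reals all_analysis.

Set Implicit Arguments.
Unset Strict Implicit.
Unset Printing Implicit Defensive.

Import Order.TTheory GRing.Theory Num.Theory.
Import numFieldNormedType.Exports.

Local Open Scope classical_set_scope.
Local Open Scope complex_scope.
Local Open Scope ring_scope.

(* A C*-algebra need not be unital, whereas [pzRingType] has a unit: the product
   is therefore a separate operation.  Norms take their (real, nonnegative)
   values in [R[i]]. *)
HB.mixin Record CompleteNormedModule_isCStarAlgebra (R : realType) A
    of CompleteNormedModule R[i] A := {
  cmul : A -> A -> A;
  star : A -> A;
  cmulA : associative cmul;
  cmulDl : left_distributive cmul +%R;
  cmulDr : right_distributive cmul +%R;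
  cscaleAl : forall (k : R[i]) (a b : A), k *: cmul a b = cmul (k *: a) b;
  cscaleAr : forall (k : R[i]) (a b : A), k *: cmul a b = cmul a (k *: b);
  starD : {morph star : a b / a + b};
  starZ : forall (k : R[i]) (a : A), star (k *: a) = Num.conj k *: star a;
  starM : forall a b : A, star (cmul a b) = cmul (star b) (star a);
  starK : involutive star;
  cnormM : forall a b : A, `|cmul a b| <= `|a| * `|b|;
  cnorm_star : forall a : A, `|cmul (star a) a| = `|a| ^+ 2
}.

#[short(type="cstarAlgType")]
HB.structure Definition CStarAlgebra (R : realType) :=
  {A of CompleteNormedModule_isCStarAlgebra R A & CompleteNormedModule R[i] A}.

Declare Scope cstar_scope.
Delimit Scope cstar_scope with cstar.
Notation "a ** b" := (cmul a b) (at level 40, left associativity) : cstar_scope.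
Local Open Scope cstar_scope.

Section CStarNotions.
Context {R : realType} {A : cstarAlgType R}.

(* The usual order of [A] is: [a <= b] iff [cpositive (b - a)]. *)
Definition cpositive (a : A) : Prop := exists b : A, a = star b ** b.

Record star_endomorphism (f : A -> A) : Prop := StarEndomorphism {
  star_endo_linear : linear f;
  star_endoM : {morph f : a b / a ** b};
  star_endo_star : {morph f : a / star a}
}.

Record positive_map (f : A -> A) : Prop := PositiveMap {
  positive_map_linear : linear f;
  positive_map_pos : forall a, cpositive a -> cpositive (f a)
}.

Record cstar_subalgebra (B : set A) : Prop := CStarSubalgebra {
  subalg0 : B 0;
  subalg_linear : forall (k : R[i]) a b, B a -> B b -> B (k *: a + b);
  subalgM : forall a b, B a -> B b -> B (a ** b);
  subalg_star : forall a, B a -> B (star a);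
  subalg_closed : closed B
}.

Record hereditary_subalgebra (B : set A) : Prop := HereditarySubalgebra {
  hereditary_subalg : cstar_subalgebra B;
  hereditary_le : forall a b,
    B b -> cpositive a -> cpositive (b - a) -> B a
}.

Record conditional_expectation (B : set A) (E : A -> A) : Prop :=
  ConditionalExpectation {
  condexp_positive : positive_map E;
  condexp_contractive : forall a, `|E a| <= `|a|;
  condexp_range : forall a, B (E a);
  condexp_id : forall b, B b -> E b = b;
  condexp_modl : forall b a, B b -> E (b ** a) = b ** E a;
  condexp_modr : forall b a, B b -> E (a ** b) = E a ** b
}.

End CStarNotions.

(* [M(A)] is the set of double centralizers of [A] (Busby): [mulL m a] is [m a]
   and [mulR m a] is [a m].  Linearity, boundedness and the module property of
   both maps follow from [mulLR]. *)
Section Multipliers.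
Context {R : realType}.

Record multiplier (A : cstarAlgType R) := Multiplier {
  mulL : A -> A;
  mulR : A -> A;
  mulLR : forall a b : A, a ** mulL b = mulR a ** b
}.

HB.instance Definition _ (A : cstarAlgType R) := gen_eqMixin (multiplier A).
HB.instance Definition _ (A : cstarAlgType R) := gen_choiceMixin (multiplier A).

Context {A : cstarAlgType R}.

Definition multiplier1 : multiplier A :=
  @Multiplier A id id (fun _ _ => erefl).

Definition multiplier_of (a : A) : multiplier A :=
  @Multiplier A (fun b => a ** b) (fun b => b ** a) (fun b c => cmulA b a c).

(* The strict topology: [m_i --> m] iff [m_i a --> m a] and [a m_i --> a m] in
   norm for every [a : A]. *)
Definition multiplier_eval (m : multiplier A) :
    ({ptws A -> A} * {ptws A -> A})%type :=
  (mulL m, mulR m).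

Definition strict_topology : topologicalType :=
  initial_topology multiplier_eval.

Definition strict_extension (f : A -> A) (F : multiplier A -> multiplier A) :
    Prop :=
  continuous (F : strict_topology -> strict_topology) /\
  forall a, F (multiplier_of a) = multiplier_of (f a).

(* The strict extension of [f]: unique when it exists, since [A] is strictly
   dense in [M(A)].  The default value [id] is a junk value. *)
Definition strict_ext (f : A -> A) : multiplier A -> multiplier A :=
  xget (id : multiplier A -> multiplier A)
    [set F | strict_extension f F].

End Multipliers.

(* [Gpos] is the positive cone, so [g >= 0] is [Gpos g] and, by totality and
   antisymmetry, [g < 0] is [~ Gpos g]. *)
Record positive_cone (G : zmodType) (Gpos : set G) : Prop := PositiveCone {
  cone0 : Gpos 0;
  coneD : forall s t, Gpos s -> Gpos t -> Gpos (s + t);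
  cone_antisym : forall t, Gpos t -> Gpos (- t) -> t = 0;
  cone_total : forall t, Gpos t \/ Gpos (- t)
}.

(* [alpha] and [L] are maps on [Gpos]; their values outside of [Gpos] are
   never used. *)
Record corner_system (R : realType) (G : zmodType) (A : cstarAlgType R)
    (Gpos : set G) (alpha L : G -> A -> A) : Prop := CornerSystem {
  corner_alpha_endo : forall t, Gpos t -> star_endomorphism (alpha t);
  corner_alpha0 : forall a, alpha 0 a = a;
  corner_alphaD : forall s t a, Gpos s -> Gpos t ->
    alpha (s + t) a = alpha s (alpha t a);
  corner_L_pos : forall t, Gpos t -> positive_map (L t);
  corner_L0 : forall a, L 0 a = a;
  corner_LD : forall s t a, Gpos s -> Gpos t -> L (s + t) a = L s (L t a);
  corner_transfer : forall t a b, Gpos t -> L t (alpha t a ** b) = a ** L t b;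
  corner_hereditary : forall t, Gpos t ->
    hereditary_subalgebra (range (alpha t));
  corner_condexp : forall t, Gpos t ->
    conditional_expectation (range (alpha t)) (alpha t \o L t)
}.

(* Only abelian groups, written additively, are considered. *)
Section FellBundles.
Context {R : realType} {G : zmodType}.

(* Elements of fibers over provably equal indices, such as [(g + h) + k] and
   [g + (h + k)], are compared in the total space. *)
Definition fell_elt (B : G -> completeNormedModType R[i]) (g : G) (b : B g) :
  {g : G & B g} := existT (fun g : G => B g : Type) g b.

Record fellBundle := FellBundle {
  fiber :> G -> completeNormedModType R[i];
  fmul : forall g h, fiber g -> fiber h -> fiber (g + h);
  fstar : forall g, fiber g -> fiber (- g);
  fmul_linearl : forall g h (c : fiber h),
    linear (fun b : fiber g => fmul b c);
  fmul_linearr : forall g h (b : fiber g),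
    linear (fun c : fiber h => fmul b c);
  fmulA : forall g h k (b : fiber g) (c : fiber h) (d : fiber k),
    fell_elt (fmul b (fmul c d)) = fell_elt (fmul (fmul b c) d);
  fstarD : forall g (b c : fiber g), fstar (b + c) = fstar b + fstar c;
  fstarZ : forall g (z : R[i]) (b : fiber g),
    fstar (z *: b) = Num.conj z *: fstar b;
  fnorm_star : forall g (b : fiber g), `|fstar b| = `|b|;
  fstarM : forall g h (b : fiber g) (c : fiber h),
    fell_elt (fstar (fmul b c)) = fell_elt (fmul (fstar c) (fstar b));
  fstarK : forall g (b : fiber g), fell_elt (fstar (fstar b)) = fell_elt b;
  fnormM : forall g h (b : fiber g) (c : fiber h),
    `|fmul b c| <= `|b| * `|c|;
  fnorm_cstar : forall g (b : fiber g), `|fmul (fstar b) b| = `|b| ^+ 2;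
  (* [b^* b] is positive in the C*-algebra [fiber 0] (cf. [cpositive]) *)
  fpositive : forall g (b : fiber g), exists c : fiber 0,
    fell_elt (fmul (fstar b) b) = fell_elt (fmul (fstar c) c)
}.

End FellBundles.
Arguments fellBundle : clear implicits.
Arguments fmul {R G} f {g h} _ _.
Arguments fstar {R G} f {g} _.

(* An element [a delta_g] is represented by its coefficient [a : A]. *)
Section CornerBundle.
Context {R : realType} {G : zmodType} {A : cstarAlgType R}.
Variables (Gpos : set G) (alpha L : G -> A -> A).

(* [alphabar_t(1)] *)
Definition corner_proj (t : G) : multiplier A :=
  strict_ext (alpha t) multiplier1.

Definition corner_fiber (g : G) : set A :=
  if g \in Gpos then range (mulR (corner_proj g))
  else range (mulL (corner_proj (- g))).

Definition corner_mul (g h : G) (a b : A) : A :=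
  if g \in Gpos then
    if h \in Gpos then a ** alpha g b
    else if g + h \in Gpos then a ** alpha (g + h) b
    else alpha (- g - h) a ** b
  else
    if h \in Gpos then
      if g + h \in Gpos then L (- g) (a ** b) else L h (a ** b)
    else alpha (- h) a ** b.

End CornerBundle.

(* Main.v *)
Require Import Defs.
From HB Require Import structures.
From mathcomp Require Import all_boot all_order all_algebra.
From mathcomp Require Import complex ring.
From mathcomp Require Import all_classical all_reals all_analysis.

(** Think of [a delta_t] as [a S_t] and of [a delta_(-t)] as [S_t^* a], for a
    semigroup of partial isometries [S] with [S_t a S_t^* = alpha_t a],
    [S_t^* a S_t = L_t a] and [S_t S_t^* = p_t], where [p_t] is the image of the
    unit under the strict extension of [alpha_t]. The six cases of the
    multiplication are the normal forms of the products of such words, and every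
    axiom of a Fell bundle reduces to the behaviour of [alpha], [L] and [p]:
    [alpha_t (L_t x) = p_t x p_t] ([endo_transfer]),
    [alpha_s (x p_t) = alpha_s x p_(s+t)] ([endo_projR]),
    [L_s (x p_(s+t)) = L_s x p_t] ([transfer_projR]) and [p_(s+t) <= p_s].
    The six formulas agree where their domains meet, and the adjoint reverses a
    product, so that associativity has to be checked for four sign patterns.
    Only the pattern (+,-,+) and its adjoint, where products [S_t S_t^*] appear
    between coefficients, require these to lie in their fibers.

    The norms: [alpha_t] is contractive because *-homomorphisms are, and so is
    [L_t], because it factors through the expectation onto the range of [alpha_t]
    and is a *-homomorphism there ([transfer_contractive]). For [a = a p_t] one
    has [alpha_t (L_t (a^* a)) = p_t a^* a p_t = a^* a], so the two contractions
    give [|L_t (a^* a)| = |a|^2]. Positivity of [L_t (a^* a)] is that of [L_t].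

    That *-homomorphisms are contractive ([hom_contractive]) is proved without
    spectral radii: a small selfadjoint element is the imaginary part of a
    unitary, so its image has norm at most [1]; this gives some bound, which the
    C*-identity improves to [1].

    The analytic core is the existence of the strict extension of [alpha_t]
    ([ext_strict]), which identifies [p_t] as the strict limit of [alpha_t u] over
    an approximate unit ([strict_ext_unit]). Since [L_t] is positive,
    it maps [x x^*] to some [d^* d]; compression by the hereditary range of
    [alpha_t] then yields [|alpha_t(n) x| <= |n d^*|] for all [n]
    ([endo_mul_bound]). This estimate gives at once the convergence of
    [alpha_t(u m) x] for every multiplier [m] and the strict continuity of the
    limit. The approximate unit comes from resolvents of selfadjoint elements,
    which exist off the real line by continuation ([quasi_resolvent_exists]).

    Finally each fiber consists of the fixed points of a multiplier, hence is a
    closed subspace of [A] and a Banach space. *)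

Set Implicit Arguments.
Unset Strict Implicit.
Unset Printing Implicit Defensive.

Import Order.TTheory GRing.Theory Num.Theory.
Import numFieldNormedType.Exports.

Local Open Scope classical_set_scope.
Local Open Scope complex_scope.
Local Open Scope ring_scope.
Local Open Scope cstar_scope.

(** * Linear identities by reflection *)

(** Products are left as atoms, so that the scalars may commute although the
    algebra does not. *)
Inductive lexpr (K : Type) :=
  | LVar of nat | LZero | LAdd of lexpr K & lexpr K | LOpp of lexpr K
  | LScale of K & lexpr K.
Arguments LVar {K} _.
Arguments LZero {K}.
Arguments LAdd {K} _ _.
Arguments LOpp {K} _.
Arguments LScale {K} _ _.

Section LinearReflection.
Context {K : nzRingType} {V : lmodType K}.
Variable env : seq V.

Fixpoint leval (e : lexpr K) : V :=
  match e with
  | LVar i => nth 0 env i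
  | LZero => 0
  | LAdd e1 e2 => leval e1 + leval e2
  | LOpp e1 => - leval e1
  | LScale k e1 => k *: leval e1
  end.

Fixpoint lcoef (e : lexpr K) (i : nat) : K :=
  match e with
  | LVar j => if eqn j i then 1 else 0
  | LZero => 0
  | LAdd e1 e2 => lcoef e1 i + lcoef e2 i
  | LOpp e1 => - lcoef e1 i
  | LScale k e1 => k * lcoef e1 i
  end.

Lemma leval_coef e : leval e = \sum_(i < size env) lcoef e i *: env`_i.
Proof.
elim: e => /= [j||e1 -> e2 ->|e1 ->|k e1 ->].
- under eq_bigr do rewrite eqnE.
  have [jlt|jge] := ltnP j (size env).
    rewrite (bigD1 (Ordinal jlt)) //= eqxx scale1r big1 ?addr0 // => i.
    by rewrite -val_eqE /= eq_sym => /negbTE ->; rewrite scale0r.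
  rewrite nth_default // big1 // => i _; case: eqP => [ji|]; last by rewrite scale0r.
  by have := ltn_ord i; rewrite -ji ltnNge jge.
- by rewrite big1 // => i _; rewrite scale0r.
- by rewrite -big_split /=; apply: eq_bigr => i _; rewrite scalerDl.
- by rewrite -sumrN; apply: eq_bigr => i _; rewrite scaleNr.
- by rewrite scaler_sumr; apply: eq_bigr => i _; rewrite scalerA.
Qed.

Fixpoint lsame (e1 e2 : lexpr K) (n : nat) : Prop :=
  if n is m.+1 then lcoef e1 m = lcoef e2 m /\ lsame e1 e2 m else True.

(** Leaves one scalar identity for each atom, to be decided by [ring] or
    [field]. *)
Lemma leval_eq e1 e2 : lsame e1 e2 (size env) -> leval e1 = leval e2.
Proof.
move=> same; rewrite !leval_coef; apply: eq_bigr => i _; congr (_ *: _).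
elim: (size env) (val i) (ltn_ord i) same => // n IH j + /= [eqn eqs].
by rewrite ltnS leq_eqVlt => /orP[/eqP->//|/IH]; apply.
Qed.
End LinearReflection.

Ltac lin_index x env :=
  lazymatch env with
  | cons x _ => constr:(0%N)
  | cons _ ?l => let i := lin_index x l in constr:(S i)
  end.
Ltac lin_insert x env :=
  lazymatch env with
  | context [cons x _] => env
  | _ => constr:(cons x env)
  end.
Ltac lin_atoms x env :=
  lazymatch x with
  | 0 => env
  | ?a + ?b => let env := lin_atoms a env in lin_atoms b env
  | - ?a => lin_atoms a env
  | _ *: ?a => lin_atoms a env
  | _ => lin_insert x env
  end.
Ltac lin_reify K x env :=
  lazymatch x with
  | 0 => constr:(@LZero K)
  | ?a + ?b => let a := lin_reify K a env in let b := lin_reify K b env in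
               constr:(@LAdd K a b)
  | - ?a => let a := lin_reify K a env in constr:(@LOpp K a)
  | ?k *: ?a => let a := lin_reify K a env in constr:(@LScale K k a)
  | _ => let i := lin_index x env in constr:(@LVar K i)
  end.
Ltac lin_with K V :=
  lazymatch goal with
  | |- @eq ?T ?x ?y =>
    let env := lin_atoms x (@nil T) in
    let env := lin_atoms y env in
    let ex := lin_reify K x env in
    let ey := lin_reify K y env in
    apply: (@leval_eq K V env ex ey);
    cbn [lsame lcoef size eqn]; repeat split
  end.
Ltac zlin G := lin_with int (zmodule G); reflexivity.

Ltac lin A :=
  lazymatch type of A with
  | cstarAlgType ?R =>
      lin_with (complex R : nzRingType) (A : lmodType (complex R))
  end.

(** * Complex numbers and fixed points *)

Section ComplexNumbers.
Context {R : realType}.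
Implicit Types x y e : R[i].

(** The order of [R[i]] is partial, so the archimedean property has to come
    from the real part. *)
Lemma complex_archi x : 0 <= x -> exists n : nat, x <= n%:R.
Proof.
move=> x0; have xr : x \is Num.real by exact: ger0_real.
rewrite -(RRe_real xr) ler0c in x0 *.
exists (Num.bound (complex.Re x)); have := ltW (archi_boundP x0).
by rewrite -lecR => /le_trans; apply; rewrite rmorph_nat.
Qed.

Lemma geometric_small x e : 0 <= x -> 0 < e -> exists n : nat, x / 2 ^+ n <= e.
Proof.
move=> x0 e0; have [n xn] := complex_archi (divr_ge0 x0 (ltW e0)).
exists n; rewrite ler_pdivrMr ?exprn_gt0 // mulrC -ler_pdivrMr //.
apply: le_trans xn _; rewrite -natrX ler_nat.
exact/ltnW/ltn_expl.
Qed.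

(** If [y < x], Bernoulli's inequality makes the powers of [x / y] exceed
    [2]. *)
Lemma le_of_pow2 x y : 0 <= x -> 0 <= y ->
  (forall n, x ^+ (2 ^ n) <= 2 * y ^+ (2 ^ n)) -> x <= y.
Proof.
move=> x0 y0 H; have [//|ltyx] := real_leP (ger0_real x0) (ger0_real y0).
have [yeq0|ypos] := eqVneq y 0.
  have xle0 : x <= 0 by have := H 0%N; rewrite expn0 !expr1 yeq0 mulr0.
  by rewrite yeq0 (le_gtF xle0) in ltyx.
have {}ypos : 0 < y by rewrite lt_def ypos.
pose q := x / y - 1.
have q0 : 0 < q by rewrite subr_gt0 ltr_pdivlMr ?mul1r.
have [n qn] := complex_archi (ltW (divr_gt0 (ltr0n _ 2) q0)).
have bern k : 1 + k%:R * q <= (1 + q) ^+ k.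
  elim: k => [|k IH]; first by rewrite mul0r addr0 expr0.
  rewrite exprS; have : (1 + q) * (1 + k%:R * q) <= (1 + q) * (1 + q) ^+ k.
    by rewrite ler_wpM2l // addr_ge0 // ltW.
  apply: le_trans; rewrite -subr_ge0.
  have -> : (1 + q) * (1 + k%:R * q) - (1 + k.+1%:R * q) = k%:R * q ^+ 2.
    by rewrite -natr1; ring.
  by rewrite mulr_ge0 // exprn_ge0 // ltW.
have := bern (2 ^ n)%N; have := H n.
rewrite -ler_pdivrMr ?exprn_gt0 // -expr_div_n.
have -> : x / y = 1 + q by rewrite /q addrC subrK.
move=> /[swap] /le_trans /[apply].
rewrite -lerBrDl; have -> : 2 - 1 = 1 :> R[i] by ring.
move=> h; have : (2 : R[i]) <= 1; last by rewrite lern1.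
apply: le_trans h; rewrite -ler_pdivrMr //; apply: le_trans qn _.
by rewrite ler_nat ltnW // ltn_expl.
Qed.

End ComplexNumbers.

Lemma cvg_norm_le {R : realType} {V W : normedModType R[i]} {T : Type}
    {F : set_system T} {FF : ProperFilter F} (f : T -> V) (g : T -> W) a b :
  f @ F --> a -> g @ F --> b -> (\forall t \near F, `|f t| <= `|g t|) ->
  `|a| <= `|b|.
Proof.
move=> fa gb fg; apply/ler_addgt0Pr => e e0.
have e20 : 0 < e / 2 by rewrite divr_gt0.
have /cvgrPdist_le /(_ _ e20) fa' := fa; have /cvgrPdist_le /(_ _ e20) gb' := gb.
near F => t.
have -> : a = (a - f t) + f t by rewrite subrK.
apply: le_trans (ler_normD _ _) _.
have h1 : `|a - f t| <= e / 2 by near: t.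
have h2 : `|f t| <= `|b| + e / 2.
  apply: (@le_trans _ _ `|g t|); first by near: t.
  have -> : g t = b - (b - g t) by zlin W.
  by apply: le_trans (ler_normB _ _) _; rewrite lerD2l; near: t.
apply: le_trans (lerD h1 h2) _.
by rewrite [X in X <= _](_ : _ = `|b| + e) //; field.
Unshelve. all: by end_near. Qed.

Section FixedPoint.
Context {R : realType} {V : completeNormedModType R[i]}.

(** The limit inherits every closed property that the iteration preserves:
    selfadjointness, commutation relations and membership in subalgebras are
    obtained in this way. *)
Lemma contraction_fixpoint (f : V -> V) (rho : R[i]) : 0 <= rho ->
  (forall y, `|y| <= rho -> `|f y| <= rho) ->
  (forall y z, `|y| <= rho -> `|z| <= rho -> `|f y - f z| <= `|y - z| / 2) ->
  exists y, [/\ `|y| <= rho, f y = y &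
    forall S : set V, closed S -> S 0 -> (forall z, S z -> S (f z)) -> S y].
Proof.
move=> rho0 fb fc; pose u n := iter n f 0.
have ub n : `|u n| <= rho by elim: n => [|n IH]; rewrite ?normr0 //=; exact: fb.
have us n : `|u n.+1 - u n| <= rho / 2 ^+ n.
  elim: n => [|n IH]; first by rewrite subr0 expr0 divr1; exact: ub.
  have := fc _ _ (ub n.+1) (ub n) => /le_trans; apply.
  by rewrite exprSr invfM mulrA ler_wpM2r // invr_ge0.
have ud n m : `|u (n + m)%N - u n| <= 2 * rho / 2 ^+ n * (1 - (2 ^+ m)^-1).
  elim: m => [|m IH]; first by rewrite addn0 !subrr normr0 expr0 invr1 subrr mulr0.
  have -> : u (n + m.+1)%N - u n = (u (n + m).+1 - u (n + m)%N) + (u (n + m)%N - u n).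
    by rewrite addnS; zlin V.
  apply: le_trans (ler_normD _ _) _; apply: le_trans (lerD (us _) IH) _.
  rewrite exprD exprS -subr_ge0.
  set a := 2 ^+ n; set b := 2 ^+ m.
  have a0 : a != 0 by rewrite expf_neq0 // pnatr_eq0.
  have b0 : b != 0 by rewrite expf_neq0 // pnatr_eq0.
  rewrite [X in 0 <= X](_ : _ = 0) //; field.
  by rewrite a0 b0.
have uC : cauchy (u n @[n --> \oo]).
  apply: cauchy_exP => e e0.
  have [n hn] : exists n, 2 * rho / 2 ^+ n <= e / 2.
    by apply: geometric_small; rewrite ?mulr_ge0 ?divr_gt0.
  exists (u n); change (\forall k \near \oo, ball (u n) e (u k)); near=> k.
  have nk : (n <= k)%N by near: k; exact: nbhs_infty_ge.
  rewrite -ball_normE /= distrC -(subnKC nk).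
  apply: le_lt_trans (ud _ _) _.
  apply: (@le_lt_trans _ _ (e / 2)); last by rewrite ltr_pdivrMr // ltr_pMr // ltr1n.
  apply: le_trans hn; apply: ler_piMr.
    by rewrite divr_ge0 ?mulr_ge0 // exprn_ge0.
  by rewrite lerBlDr lerDl invr_ge0 exprn_ge0.
have [y uy] : exists y : V, u n @[n --> \oo] --> y.
  by exists (lim (u n @[n --> \oo])); exact: (@cauchy_cvg V (u n @[n --> \oo]) _ uC).
have yrho : `|y| <= rho.
  rewrite -[leRHS](ger0_norm rho0).
  have rhocvg : (rho : R[i]^o) @[n --> \oo] --> (rho : R[i]^o) by exact: cvg_cst.
  apply: (cvg_norm_le uy rhocvg).
  by apply: nearW => n; rewrite [leRHS]ger0_norm.
have fu : f (u n) @[n --> \oo] --> f y.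
  apply/cvgrPdist_le => e e0; have /cvgrPdist_le /(_ _ e0) := uy.
  apply: filterS => n; apply: le_trans; apply: le_trans (fc _ _ _ _) _ => //.
  by rewrite ler_pdivrMr // ler_peMr // ler1n.
exists y; split=> //.
  have fu' : f (u n) @[n --> \oo] --> y by rewrite -cvg_shiftS in uy.
  exact: (cvg_unique _ fu fu').
move=> S cS S0 Sf; apply: (closed_cvg _ cS _ _ uy); apply: nearW.
by elim=> //= n; exact: Sf.
Unshelve. all: by end_near. Qed.

End FixedPoint.

(** * Elementary properties of C*-algebras *)

Section CStarBasics.
Context {R : realType} {A : cstarAlgType R}.
Implicit Types (a b c x y : A) (k : R[i]).

Lemma cmul0l a : 0 ** a = 0.
Proof. by have := cmulDl (0 : A) 0 a; rewrite addr0 => /(canLR (addKr _)) <-; rewrite addNr. Qed.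

Lemma cmul0r a : a ** 0 = 0.
Proof. by have := cmulDr a (0 : A) 0; rewrite addr0 => /(canLR (addKr _)) <-; rewrite addNr. Qed.

Lemma cmulNl a b : (- a) ** b = - (a ** b).
Proof. by apply/eqP; rewrite -addr_eq0 -cmulDl addNr cmul0l. Qed.

Lemma cmulNr a b : a ** (- b) = - (a ** b).
Proof. by apply/eqP; rewrite -addr_eq0 -cmulDr addNr cmul0r. Qed.

Lemma cmulZl k a b : (k *: a) ** b = k *: (a ** b).
Proof. by rewrite cscaleAl. Qed.

Lemma cmulZr k a b : a ** (k *: b) = k *: (a ** b).
Proof. by rewrite cscaleAr. Qed.

Lemma star0 : star (0 : A) = 0.
Proof. by have := starD (0 : A) 0; rewrite addr0 => /(canLR (addKr _)) <-; rewrite addNr. Qed.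

Lemma starN a : star (- a) = - star a.
Proof. by apply/eqP; rewrite -addr_eq0 -starD addNr star0. Qed.

Lemma starB a b : star (a - b) = star a - star b.
Proof. by rewrite starD starN. Qed.

Definition cmulE := (@cmulDl R A, @cmulDr R A, cmulNl, cmulNr, cmulZl, cmulZr,
  cmul0l, cmul0r, @cmulA R A).

Definition starE := (@starM R A, @starD R A, starN, @starZ R A, @starK R A, star0).

Lemma norm_star a : `|star a| = `|a|.
Proof.
have le b : `|b| <= `|star b|.
  have [->|b0] := eqVneq b 0; first by rewrite star0.
  rewrite -(@ler_pM2l _ `|b|) ?normr_gt0 // -expr2 -cnorm_star [leRHS]mulrC.
  exact: cnormM.
by apply: le_anti; rewrite le andbT -[leRHS](congr1 _ (starK a)) le.
Qed.

Lemma cnorm_starr a : `|a ** star a| = `|a| ^+ 2.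
Proof. by rewrite -{1}(starK a) cnorm_star norm_star. Qed.

Lemma star_mul_eq0 a : star a ** a = 0 -> a = 0.
Proof.
by move/(congr1 Num.norm); rewrite cnorm_star normr0 => /eqP; rewrite sqrf_eq0 normr_eq0 => /eqP.
Qed.

Lemma mul_star_eq0 a : a ** star a = 0 -> a = 0.
Proof.
by move=> h; rewrite -(starK a) (@star_mul_eq0 (star a)) ?star0 // starK.
Qed.

Lemma cmul_eq0l a : (forall b, a ** b = 0) -> a = 0.
Proof. by move=> h; apply: mul_star_eq0. Qed.

Lemma cmul_injr a a' : (forall b, a ** b = a' ** b) -> a = a'.
Proof.
move=> h; apply/eqP; rewrite -subr_eq0; apply/eqP/cmul_eq0l => b.
by rewrite cmulDl cmulNl h subrr.
Qed.

Lemma cmul_injl a a' : (forall b, b ** a = b ** a') -> a = a'.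
Proof.
move=> h; rewrite -(starK a) -(starK a'); congr star; apply: cmul_injr => b.
by rewrite -(starK b) -!starM h.
Qed.

(** Norms are compared through squares [a^* a], which can be computed
    algebraically. *)
Lemma ler_norm_star a b : `|star a ** a| <= `|star b ** b| -> `|a| <= `|b|.
Proof. by rewrite !cnorm_star ler_pXn2r // nnegrE. Qed.

Section Limits.
Context {T : Type} {F : set_system T} {FF : ProperFilter F}.
Implicit Types f g : T -> A.

Lemma cvg_cmul f g a b :
  f @ F --> a -> g @ F --> b -> (fun t => f t ** g t) @ F --> a ** b.
Proof.
move=> fa gb; apply/cvgrPdist_le => e e0.
pose M := `|a| + `|b| + 1.
have M0 : 0 < M by rewrite ltr_wpDl // addr_ge0.
have Me0 : 0 < M + e by rewrite addr_gt0.
pose d := e / (M + e).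
have d0 : 0 < d by rewrite divr_gt0.
have d1 : d <= 1 by rewrite ler_pdivrMr // mul1r lerDr ltW.
have dM : d * M <= e.
  by rewrite /d mulrAC ler_pdivrMr // ler_wpM2l ?(ltW e0) // lerDl ltW.
have /cvgrPdist_le /(_ _ d0) fa' := fa; have /cvgrPdist_le /(_ _ d0) gb' := gb.
near=> t.
have h1 : `|a - f t| <= d by near: t.
have h2 : `|b - g t| <= d by near: t.
have -> : a ** b - f t ** g t =
    a ** (b - g t) + (a - f t) ** b - (a - f t) ** (b - g t).
  by rewrite !cmulE; lin A; ring.
apply: le_trans (ler_normB _ _) _.
apply: le_trans (lerD (ler_normD _ _) (lexx _)) _.
have k1 : `|a ** (b - g t)| <= `|a| * d.
  by apply: le_trans (cnormM _ _) _; rewrite ler_wpM2l.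
have k2 : `|(a - f t) ** b| <= d * `|b|.
  by apply: le_trans (cnormM _ _) _; rewrite ler_wpM2r.
have k3 : `|(a - f t) ** (b - g t)| <= d * 1.
  apply: le_trans (cnormM _ _) _; apply: ler_pM => //.
  exact: le_trans d1.
apply: le_trans (lerD (lerD k1 k2) k3) _; apply: le_trans dM.
by rewrite [X in X <= _](_ : _ = d * M) // /M; ring.
Unshelve. all: by end_near. Qed.

Lemma cvg_cmull f a b : f @ F --> a -> (fun t => b ** f t) @ F --> b ** a.
Proof. by move=> fa; have := FF => ?; apply: cvg_cmul => //; apply: cvg_cst. Qed.

Lemma cvg_cmulr f a b : f @ F --> a -> (fun t => f t ** b) @ F --> a ** b.
Proof. by move=> fa; have := FF => ?; apply: cvg_cmul => //; apply: cvg_cst. Qed.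

Lemma cvg_star f a : f @ F --> a -> (fun t => star (f t)) @ F --> star a.
Proof.
move=> fa; apply/cvgrPdist_le => e e0; have /cvgrPdist_le /(_ _ e0) := fa.
by apply: filterS => t; rewrite -starB norm_star.
Qed.

Lemma cvg_ext f g a : f =1 g -> f @ F --> a -> g @ F --> a.
Proof. by move=> /funext ->. Qed.

Lemma cvg_near_eq f g a :
  (\forall t \near F, f t = g t) -> f @ F --> a -> g @ F --> a.
Proof. by move=> fg fa; apply: cvg_trans fa; apply: near_eq_cvg. Qed.

Lemma cvg_le_norm {V : normedModType R[i]} f (g : T -> V) a :
  g @ F --> (0 : V) -> (\forall t \near F, `|f t - a| <= `|g t|) -> f @ F --> a.
Proof.
move=> g0 fg; apply/cvgrPdist_le => e e0; have /cvgrPdist_le /(_ _ e0) g0' := g0.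
near=> t; rewrite distrC; apply: (@le_trans _ _ `|g t|); first by near: t.
by rewrite -normrN -sub0r; near: t.
Unshelve. all: by end_near. Qed.

End Limits.

Lemma closed_equalizer (f g : A -> A) : continuous f -> continuous g ->
  closed [set x | f x = g x].
Proof.
move=> fc gc; have -> : [set x | f x = g x] = (f \- g) @^-1` [set 0].
  apply/seteqP; split => x /=; first by move=> ->; rewrite subrr.
  by move/eqP; rewrite subr_eq0 => /eqP.
apply: preimage_closed; last first.
  by apply: accessible_closed_set1; apply: hausdorff_accessible; exact: norm_hausdorff.
by move=> x _; apply: cvgB; [exact: fc|exact: gc].
Qed.

End CStarBasics.

(** * Resolvents and approximate units *)

Section Resolvents.
Context {R : realType} {A : cstarAlgType R}.
Implicit Types (a b c x y h r : A) (k e : R[i]).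

(** [1 - s] is the inverse of [1 + x]. *)
Lemma quasi_inverse x : `|x| <= 2^-1 -> exists s, s = x - x ** s.
Proof.
move=> x2; have [||s] := @contraction_fixpoint R A (fun s => x - x ** s) 1 ler01.
- move=> y y1; apply: le_trans (ler_normB _ _) _.
  rewrite (splitr 1) mul1r; apply: lerD => //; apply: le_trans (cnormM _ _) _.
  by rewrite -[leRHS]mulr1; apply: ler_pM.
- move=> y z _ _; rewrite [_ - _ - _](_ : _ = - (x ** (y - z))); last first.
    by rewrite !cmulE; lin A; ring.
  rewrite normrN; apply: le_trans (cnormM _ _) _.
  by rewrite [leRHS]mulrC ler_wpM2r.
by case=> _ /esym fs _; exists s.
Qed.

(** [r] stands for [h (h + i e)^-1]: the resolvent itself lives outside of a
    nonunital algebra. *)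
Definition quasi_resolvent h e r := h = h ** r + ('i * e) *: r.

Lemma conj_imag e : 0 < e -> Num.conj ('i * e) = - ('i * e).
Proof. by move=> e0; rewrite rmorphM /= conjCi mulNr conj_Creal // gtr0_real. Qed.

Lemma imag_neq0 e : 0 < e -> 'i * e != 0 :> R[i].
Proof. by move=> e0; rewrite mulf_neq0 ?neq0Ci // gt_eqF. Qed.

(** The equation says that the Cayley transform [2 r - 1] of [h] is an
    isometry; it results from computing [r^* h r] in two ways. *)
Lemma quasi_resolvent_real h e r : star h = h -> 0 < e ->
  quasi_resolvent h e r -> r + star r = star r ** r + star r ** r.
Proof.
move=> hs e0 hr; have ie0 := imag_neq0 e0.
have hr' : h = star r ** h - ('i * e) *: star r.
  by rewrite -{1}hs {1}hr !starE hs conj_imag // scaleNr.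
have e1 : star r ** h = star r ** h ** r + ('i * e) *: (star r ** r).
  by rewrite {1}hr !cmulE.
have e2 : h ** r = star r ** h ** r - ('i * e) *: (star r ** r).
  by rewrite {1}hr' !cmulE.
have : ('i * e) *: (r + star r) = ('i * e) *: (star r ** r + star r ** r).
  apply/eqP; rewrite -subr_eq0; apply/eqP.
  transitivity ((h ** r + ('i * e) *: r) - (star r ** h - ('i * e) *: star r)).
    by rewrite e1 e2; lin A; ring.
  by rewrite -hr -hr' subrr.
by move/(scalerI ie0).
Qed.

(** The multiplication operator of [1 - w] makes sense without a unit. *)
Definition lcontr w := forall y, `|y - w ** y| <= `|y|.

(** The hypothesis says that [1 - q] is an isometry, written without a unit. *)
Lemma quasi_unitary_lcontr q : star q ** q = q + star q -> lcontr q.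
Proof.
move=> qq y; apply: ler_norm_star.
rewrite [X in `|X|](_ : _ = star y ** y) //.
rewrite !(starE, cmulE) -[star y ** star q ** q]cmulA qq.
by rewrite !cmulE; lin A; ring.
Qed.

Lemma quasi_resolvent_contr h e r : star h = h -> 0 < e ->
  quasi_resolvent h e r -> lcontr r /\ `|r| <= 1.
Proof.
move=> hs e0 hr; have rr := quasi_resolvent_real hs e0 hr.
(* [1 - (r + r)] is the opposite of the Cayley transform of [h] *)
have iso : lcontr (r + r).
  by apply: quasi_unitary_lcontr; rewrite !(starE, cmulE) -rr; lin A; ring.
have half y z : `|y| <= `|z| -> `|2^-1 *: (y + z)| <= `|z|.
  move=> yz; rewrite normrZ normfV normr_nat ler_pdivrMl //.
  apply: le_trans (ler_normD _ _) _; apply: le_trans (lerD yz (lexx _)) _.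
  by rewrite -mulr2n mulr_natl.
have rc : lcontr r.
  move=> y; rewrite [X in `|X|](_ : _ = 2^-1 *: (y - (r + r) ** y + y)).
    exact/half/iso.
  by rewrite !cmulE; lin A; field.
have rn y : `|r ** y| <= `|y|.
  rewrite [X in `|X|](_ : _ = 2^-1 *: (- (y - (r + r) ** y) + y)).
    by apply: half; rewrite normrN; exact: iso.
  by rewrite !cmulE; lin A; field.
split=> //; have := rn (star r); rewrite cnorm_starr norm_star.
have [->|r0] := eqVneq r 0; first by rewrite normr0.
by rewrite expr2 -ler_pdivlMr ?normr_gt0 // divff // normr_eq0.
Qed.

(** The resolvent identity: [1 - r'] is [(1 - r) (1 + k r)^-1], where the
    inverse exists because [|k r| <= 1/2]. *)
Lemma quasi_resolvent_step h e e' r k : star h = h -> 0 < e' -> 0 <= k <= 2^-1 ->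
  e = (1 + k) * e' -> quasi_resolvent h e r -> exists r', quasi_resolvent h e' r'.
Proof.
move=> hs e'0 /andP[k0 k2] ee' hr.
have e0 : 0 < e by rewrite ee' mulr_gt0 // ltr_wpDr.
have [_ r1] := quasi_resolvent_contr hs e0 hr.
have [s ss] : exists s, s = k *: r - (k *: r) ** s.
  apply: quasi_inverse; rewrite normrZ ger0_norm // -[leRHS]mulr1.
  exact: ler_pM.
exists (r + s - r ** s); rewrite /quasi_resolvent.
have h1 : h - h ** r = ('i * e) *: r by rewrite {1}hr addrC addKr.
have h2 : h ** s - h ** r ** s = ('i * e) *: (r ** s).
  by rewrite -cmulNl -cmulDl h1 cmulZl.
apply/eqP; rewrite -subr_eq0; apply/eqP.
transitivity ((h - h ** r) - (h ** s - h ** r ** s)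
    - ('i * e') *: r - ('i * e') *: s + ('i * e') *: (r ** s)).
  by rewrite !cmulE; lin A; ring.
rewrite h1 h2 ee'.
transitivity (('i * e') *: (k *: r - (k *: r) ** s - s)).
  by rewrite !cmulE; lin A; ring.
by rewrite -ss subrr scaler0.
Qed.

(** The spectrum of a selfadjoint element is real: the resolvent set contains
    [i e] for large [e], and can be followed down to every [e > 0] because the
    resolvents stay bounded. *)
Lemma quasi_resolvent_exists h e : star h = h -> 0 < e ->
  exists r, quasi_resolvent h e r.
Proof.
move=> hs e0; have [n hn] := @geometric_small R (2 * `|h|) e (mulr_ge0 (ler0n _ _) (normr_ge0 _)) e0.
have big d : 0 < d -> 2 * `|h| <= d -> exists r, quasi_resolvent h d r.
  move=> d0 hd; have id0 := imag_neq0 d0.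
  have [r rr] : exists r, r = ('i * d)^-1 *: h - (('i * d)^-1 *: h) ** r.
    apply: quasi_inverse; rewrite normrZ normfV normrM normCi mul1r gtr0_norm //.
    by rewrite ler_pdivrMl // mulrC ler_pdivlMl.
  exists r; rewrite /quasi_resolvent [X in _ *: X]rr !cmulE scalerBr !scalerA divff // !scale1r.
  by rewrite addrC subrK.
have halve d : 0 < d -> (exists r, quasi_resolvent h (2 * d) r) ->
    exists r, quasi_resolvent h d r.
  (* the two steps are [2 = (1 + 1/2) * (4/3)] and [4/3 = 1 + 1/3] *)
  move=> d0 [r hr].
  have [r' hr'] : exists r', quasi_resolvent h (4 / 3 * d) r'.
    apply: (@quasi_resolvent_step _ _ _ _ 2^-1 hs _ _ _ hr).
    - by rewrite mulr_gt0 // divr_gt0.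
    - by rewrite invr_ge0 ler0n lexx.
    - by field.
  apply: (@quasi_resolvent_step _ _ d _ 3^-1 hs _ _ _ hr') => //.
    by rewrite invr_ge0 ler0n lef_pV2 ?posrE ?ltr0n // ler_nat.
  by field.
have : exists r, quasi_resolvent h (2 ^+ n * e) r.
  by apply: big; rewrite ?mulr_gt0 ?exprn_gt0 // -ler_pdivrMl ?exprn_gt0 // mulrC.
elim: (n) => [|m IH]; first by rewrite expr0 mul1r.
by rewrite exprS -mulrA => /halve hm; apply/IH/hm; rewrite mulr_gt0 // exprn_gt0.
Qed.

(** An operator and its adjoint have the same norm. *)
Lemma lcontr_star w : lcontr w -> lcontr (star w).
Proof.
move=> wc y; set z := y - _.
have [->|z0] := eqVneq z 0; first by rewrite normr0.
rewrite -(@ler_pM2l _ `|z|) ?normr_gt0 // -expr2 -cnorm_star.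
have -> : star z ** z = star y ** (z - w ** z) by rewrite /z !(starE, cmulE); lin A; ring.
apply: le_trans (cnormM _ _) _; rewrite norm_star mulrC ler_wpM2r //.
Qed.

(** Take [w] adjoint to the quasi-resolvent [r] of [x x^*] at [e^2]; the square
    of the norm to be bounded is at most that of [x x^* (1 - r)], which is
    [e^2 r] up to a phase. *)
Lemma lcontr_small x e : 0 < e -> exists w, lcontr w /\ `|x - w ** x| <= e.
Proof.
move=> e0; have e2 : 0 < e ^+ 2 by rewrite exprn_gt0.
have hs : star (x ** star x) = x ** star x by rewrite !starE.
have [r hr] := quasi_resolvent_exists hs e2.
have [rc r1] := quasi_resolvent_contr hs e2 hr.
exists (star r); split; first exact: lcontr_star.
rewrite -(@ler_pXn2r _ 2) ?nnegrE ?(ltW e0) // -cnorm_starr.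
have -> : (x - star r ** x) ** star (x - star r ** x) =
  (x ** star x - x ** star x ** r) - star r ** (x ** star x - x ** star x ** r).
  by rewrite !(starE, cmulE); lin A; ring.
apply: le_trans (lcontr_star rc _) _.
have -> : x ** star x - x ** star x ** r = ('i * e ^+ 2) *: r.
  by rewrite {1}hr addrC addKr.
by rewrite normrZ normrM normCi mul1r gtr0_norm // ler_piMr // ltW.
Qed.

(** One factor [1 - v] is multiplied in for each element; being contractions,
    later factors do not spoil the smallness gained from earlier ones. *)
Lemma lcontr_seq (s : seq A) e : 0 < e ->
  exists w, lcontr w /\ forall x, x \in s -> `|x - w ** x| <= e.
Proof.
move=> e0; elim: s => [|x s [w [wc ws]]].
  by exists 0; split=> // y; rewrite cmul0l subr0.
have [v [vc vx]] := lcontr_small (x - w ** x) e0.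
have mul y : y - (w + v - v ** w) ** y = (y - w ** y) - v ** (y - w ** y).
  by rewrite !cmulE; lin A; ring.
exists (w + v - v ** w); split=> y; first by rewrite mul (le_trans (vc _)).
by rewrite mul inE => /predU1P[->//|/ws]; apply: le_trans.
Qed.

(** [1 - u] is taken of the form [v^* v] with [v = 1 - w], which makes [u]
    selfadjoint. *)
Lemma selfadjoint_approx (s : seq A) e : 0 < e ->
  exists u, [/\ star u = u, lcontr u & forall x, x \in s -> `|x - u ** x| <= e].
Proof.
move=> e0; have [w [wc ws]] := lcontr_seq s e0.
have mul y : y - (w + star w - star w ** w) ** y = (y - w ** y) - star w ** (y - w ** y).
  by rewrite !cmulE; lin A; ring.
exists (w + star w - star w ** w); split=> [|y|x /ws xs].
- by rewrite !starE; lin A; ring.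
- by rewrite mul; apply: le_trans (lcontr_star wc _) (wc _).
by rewrite mul; apply: le_trans (lcontr_star wc _) xs.
Qed.

(** Since its members are selfadjoint, this left approximate unit is also a
    right one. *)
Definition approx_unit : set_system A :=
  filter_from [set p : seq A * R[i] | 0 < p.2]
    (fun p => [set u | [/\ star u = u, lcontr u &
                           forall x, x \in p.1 -> `|x - u ** x| <= p.2]]).

Global Instance approx_unit_filter : ProperFilter approx_unit.
Proof.
apply: filter_from_proper; last first.
  by move=> [s e] /= e0; have [u] := selfadjoint_approx s e0; exists u.
apply: filter_from_filter; first by exists ([::], 1) => /=.
move=> [s e] [s' e'] /= e0 e'0.
(* the order of [R[i]] is partial; this is a lower bound of [e] and [e'] *)
exists (s ++ s', (e^-1 + e'^-1)^-1) => /=; first by rewrite invr_gt0 addr_gt0 ?invr_gt0.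
have le1 : (e^-1 + e'^-1)^-1 <= e.
  by rewrite -[leRHS]invrK lef_pV2 ?posrE ?addr_gt0 ?invr_gt0 // lerDl ltW ?invr_gt0.
have le2 : (e^-1 + e'^-1)^-1 <= e'.
  by rewrite -[leRHS]invrK lef_pV2 ?posrE ?addr_gt0 ?invr_gt0 // lerDr ltW ?invr_gt0.
move=> u [us uc ux]; split; split=> // x xs.
  by apply: le_trans le1; apply: ux; rewrite mem_cat xs.
by apply: le_trans le2; apply: ux; rewrite mem_cat xs orbT.
Qed.

Lemma approx_unit_star : \forall u \near approx_unit, star u = u.
Proof. by exists ([::], 1) => //= u []. Qed.

Lemma approx_unit_l x : u ** x @[u --> approx_unit] --> x.
Proof.
apply/cvgrPdist_le => e e0; exists ([:: x], e) => //= u [_ _]; apply.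
by rewrite inE.
Qed.

Lemma approx_unit_r x : x ** u @[u --> approx_unit] --> x.
Proof.
have xu : star (u ** star x) @[u --> approx_unit] --> star (star x).
  by apply: cvg_star; exact: approx_unit_l.
rewrite starK in xu; apply: cvg_near_eq xu.
by apply: filterS approx_unit_star => u us; rewrite starM starK us.
Qed.

End Resolvents.
Arguments approx_unit {R} A.
Arguments approx_unit_l {R A} x.
Arguments approx_unit_r {R A} x.

(** * Homomorphisms are contractive *)

Section Linear.
Context {R : realType} {A : cstarAlgType R} {f : A -> A}.
Hypothesis fl : linear f.

Lemma linearD_of a b : f (a + b) = f a + f b.
Proof. by have := fl 1 a b; rewrite !scale1r. Qed.

Lemma linear0_of : f 0 = 0.
Proof. by have := linearD_of 0 0; rewrite addr0 => /(canLR (addKr _)) <-; rewrite addNr. Qed.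

Lemma linearZ_of (k : R[i]) a : f (k *: a) = k *: f a.
Proof. by have := fl k a 0; rewrite linear0_of !addr0. Qed.

Lemma linearN_of a : f (- a) = - f a.
Proof. by rewrite -scaleN1r linearZ_of scaleN1r. Qed.

Lemma linearB_of a b : f (a - b) = f a - f b.
Proof. by rewrite linearD_of linearN_of. Qed.

End Linear.

Section Homomorphisms.
Context {R : realType} {A : cstarAlgType R}.
Implicit Types (a b c g h x y q : A) (k e : R[i]).

(** [y] is [1 - sqrt (1 - g)], obtained as the fixed point of
    [z |-> (g + z^2) / 2] instead of a power series. *)
Lemma quasi_sqrt g : `|g| <= 4^-1 -> exists y, y + y = g + y ** y /\
  forall S : set A, closed S -> S 0 ->
    (forall z, S z -> S (2^-1 *: (g + z ** z))) -> S y.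
Proof.
move=> g4; have h2 : `|2^-1 : R[i]| = 2^-1 by rewrite normfV normr_nat.
have [|||y [_ yy yS]] :=
    @contraction_fixpoint R A (fun z => 2^-1 *: (g + z ** z)) 2^-1.
- by rewrite invr_ge0 ler0n.
- move=> y y2; rewrite normrZ h2 ler_piMr ?invr_ge0 ?ler0n //.
  apply: le_trans (ler_normD _ _) _; apply: (@le_trans _ _ (4^-1 + 2^-1 * 2^-1)).
    by apply: lerD => //; apply: le_trans (cnormM _ _) _; apply: ler_pM.
  rewrite [X in X <= _](_ : _ = 2^-1); last by field.
  by rewrite invf_le1 ?ler1n // ltr0n.
- move=> y z y2 z2; rewrite -scalerBr normrZ h2 mulrC ler_wpM2r ?invr_ge0 ?ler0n //.
  rewrite [X in `|X|](_ : _ = y ** (y - z) + (y - z) ** z); last first.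
    by rewrite !cmulE; lin A; ring.
  apply: le_trans (ler_normD _ _) _; rewrite (splitr `|y - z|).
  apply: lerD; apply: le_trans (cnormM _ _) _; first by rewrite mulrC ler_wpM2l.
  exact: ler_wpM2l.
exists y; split=> //; rewrite -{1 2}yy -scalerDl -[RHS]scale1r; congr (_ *: _).
by field.
Qed.

Section Contractive.
Context {B : set A} {f : A -> A}.
Hypotheses (subB : cstar_subalgebra B) (fl : linear f).
Hypothesis fM : forall a b, B a -> B b -> f (a ** b) = f a ** f b.
Hypothesis fS : forall a, B a -> f (star a) = star (f a).

Let BD a b : B a -> B b -> B (a + b).
Proof. by move=> Ba Bb; have := subalg_linear subB 1 Ba Bb; rewrite scale1r. Qed.

Let BZ k a : B a -> B (k *: a).
Proof.
by move=> Ba; have := subalg_linear subB k Ba (subalg0 subB); rewrite addr0.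
Qed.

(** A selfadjoint [h] of small norm is, up to sign, the imaginary part of a
    unitary [1 - q] with [q] in the algebra, and [f] carries unitaries to
    unitaries. *)
Lemma hom_selfadjoint_small h : B h -> star h = h -> `|h| <= 2^-1 -> `|f h| <= 1.
Proof.
move=> Bh hs h2.
have hh : `|h ** h| <= 4^-1.
  apply: le_trans (cnormM _ _) _; rewrite [leRHS](_ : _ = 2^-1 * 2^-1); last by field.
  exact: ler_pM.
have [y [yy yS]] := quasi_sqrt hh.
have By : B y.
  apply: (yS B (Defs.subalg_closed subB) (subalg0 subB)) => z Bz.
  by apply/BZ/BD; exact: (subalgM subB).
have ys : star y = y.
  apply: (yS [set z | star z = z]) => [||z /= zs]; last 2 first.
  - exact: star0.
  - by rewrite !starE hs zs conj_Creal // realV realn.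
  by apply: closed_equalizer => z; [apply: cvg_star|]; apply: cvg_id.
have yh : y ** h = h ** y.
  apply: (yS [set z | z ** h = h ** z]) => [||z /= zh]; last 2 first.
  - by rewrite /= cmul0l cmul0r.
  - by rewrite !cmulE -[z ** z ** h]cmulA zh cmulA zh.
  by apply: closed_equalizer => z; [apply: cvg_cmulr|apply: cvg_cmull]; apply: cvg_id.
pose q := y + 'i *: h.
have qs : star q = y - 'i *: h by rewrite !starE hs ys /= conjCi scaleNr.
have i2 : 'i * 'i = -1 :> R[i] by rewrite -expr2 sqrCi.
have q1 : star q ** q = q + star q.
  rewrite qs /q !cmulE yh !scalerA i2 scaleN1r.
  transitivity (y + y); last by lin A; ring.
  by rewrite yy; lin A; ring.
have q2 : q ** star q = q + star q.
  rewrite qs /q !cmulE yh !scalerA i2 scaleN1r.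
  transitivity (y + y); last by lin A; ring.
  by rewrite yy; lin A; ring.
have Bq : B q by apply: BD => //; exact: BZ.
have Bq' : B (star q) by exact: (subalg_star subB).
have Q1 : lcontr (f q).
  apply: quasi_unitary_lcontr.
  by rewrite -(fS Bq) -(fM Bq' Bq) q1 (linearD_of fl).
have Q2 : lcontr (star (f q)).
  apply: quasi_unitary_lcontr.
  by rewrite starK -(fS Bq) -(fM Bq Bq') q2 (linearD_of fl) addrC.
have fh x : `|f h ** x| <= `|x|.
  have : `|(2 * 'i) *: (f h ** x)| <= `|x| + `|x|.
    rewrite [X in `|X|](_ : _ = (x - star (f q) ** x) - (x - f q ** x)).
      by apply: le_trans (ler_normB _ _) _; apply: lerD; [exact: Q2|exact: Q1].
    rewrite -(fS Bq) qs /q (linearB_of fl) (linearD_of fl) (linearZ_of fl) !cmulE.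
    by lin A; ring.
  by rewrite normrZ normrM normr_nat normCi mulr1 -mulr2n -[leRHS]mulr_natl ler_pM2l.
have := fh (star (f h)); rewrite cnorm_starr norm_star.
have [->|r0] := eqVneq (f h) 0; first by rewrite normr0.
by rewrite expr2 -ler_pdivlMr ?normr_gt0 // divff // normr_eq0.
Qed.

Lemma hom_selfadjoint_bounded h : B h -> star h = h -> `|f h| <= 2 * `|h|.
Proof.
move=> Bh hs; have [->|h0] := eqVneq h 0; first by rewrite (linear0_of fl) normr0 mulr0.
have nh : 0 < 2 * `|h| by rewrite mulr_gt0 ?normr_gt0.
have := @hom_selfadjoint_small ((2 * `|h|)^-1 *: h) (BZ _ Bh).
rewrite starZ hs conj_Creal ?realV ?gtr0_real // => /(_ erefl).
rewrite (linearZ_of fl) !normrZ normfV !(gtr0_norm nh) => H.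
rewrite -[leRHS]mulr1 -ler_pdivrMl //; apply: H.
by rewrite invfM -mulrA mulVf ?mulr1 // normr_eq0.
Qed.

(** Since [|h^2| = |h|^2] for selfadjoint [h], any bound on a homomorphism
    improves to [1]. *)
Lemma hom_contractive b : B b -> `|f b| <= `|b|.
Proof.
move=> Bb; have pow n h : B h -> star h = h -> `|f h| ^+ (2 ^ n) <= 2 * `|h| ^+ (2 ^ n).
  elim: n h => [|n IH] h Bh hs; first by rewrite expn0 !expr1; exact: hom_selfadjoint_bounded.
  have := IH (h ** h) (subalgM subB Bh Bh); rewrite starM hs => /(_ erefl).
  have sq z : star z = z -> `|z ** z| = `|z| ^+ 2 by move=> zs; rewrite -{1}zs cnorm_star.
  by rewrite fM // !sq // -?fS ?hs // -!exprM -!expnS.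
apply: ler_norm_star; rewrite -fS // -fM //; last exact: (subalg_star subB).
apply: le_of_pow2 => // n; apply: pow; last by rewrite !starE.
by apply: (subalgM subB) => //; exact: (subalg_star subB).
Qed.

End Contractive.

End Homomorphisms.

(** * A single corner *)

Section Polarization.
Context {R : realType} {V W : lmodType R[i]} (D : set V) (U : set W) (S : V -> V -> W).
Hypotheses (DD : forall x y, D x -> D y -> D (x + y))
  (DZ : forall (k : R[i]) x, D x -> D (k *: x)).
Hypotheses (UD : forall x y, U x -> U y -> U (x + y))
  (UZ : forall (k : R[i]) x, U x -> U (k *: x)).
Hypotheses (SDl : forall x y z, S (x + y) z = S x z + S y z)
  (SDr : forall x y z, S x (y + z) = S x y + S x z)
  (SZl : forall k x y, S (k *: x) y = Num.conj k *: S x y)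
  (SZr : forall k x y, S x (k *: y) = k *: S x y).

Lemma polarization : (forall x, D x -> U (S x x)) ->
  forall x y, D x -> D y -> U (S x y).
Proof.
move=> US; have sym x y : D x -> D y -> U (S x y + S y x).
  move=> Dx Dy; have := UD (US _ (DD Dx Dy)) (UZ (-1) (UD (US _ Dx) (US _ Dy))).
  rewrite SDl !SDr; congr U.
  lin_with (R[i] : nzRingType) W; ring.
move=> x y Dx Dy; have Diy : D ('i *: y) by exact: DZ.
have := UZ 2^-1 (UD (sym _ _ Dx Dy) (UZ (- 'i) (sym _ _ Dx Diy))).
rewrite SZl SZr /= conjCi; congr U.
rewrite !(scalerDr, scalerA).
have i2 : 'i * 'i = -1 :> R[i] by rewrite -expr2 sqrCi.
rewrite !(mulrN, mulNr) -!mulrA i2.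
by lin_with (R[i] : nzRingType) W; field.
Qed.

End Polarization.

Section Corner.
Context {R : realType} {A : cstarAlgType R}.
Implicit Types (a b c d x y n u : A) (k : R[i]) (m : multiplier A).

(** What a corner system provides at one index of the cone. *)
Record corner (f l : A -> A) : Prop := Corner {
  corner_endo : star_endomorphism f;
  corner_pos : positive_map l;
  corner_trans : forall a b, l (f a ** b) = a ** l b;
  corner_her : hereditary_subalgebra (range f);
  corner_exp : conditional_expectation (range f) (f \o l)
}.

Context {f l : A -> A} (fl : corner f l).

Local Notation B := (range f).
Let flin : linear f := star_endo_linear (corner_endo fl).
Let llin : linear l := positive_map_linear (corner_pos fl).
Let fM a b : f (a ** b) = f a ** f b := star_endoM (corner_endo fl) a b.
Let fS a : f (star a) = star (f a) := star_endo_star (corner_endo fl) a.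
Let subB : cstar_subalgebra B := hereditary_subalg (corner_her fl).
Let Bf a : B (f a). Proof. by exists a. Qed.

Let BD a b : B a -> B b -> B (a + b).
Proof. by move=> [x _ <-] [y _ <-]; rewrite -(linearD_of flin). Qed.

Let BZ k a : B a -> B (k *: a).
Proof. by move=> [x _ <-]; rewrite -(linearZ_of flin). Qed.

Lemma corner_endo_contractive a : `|f a| <= `|a|.
Proof.
by apply: (@hom_contractive _ _ setT f).
Qed.

Lemma corner_endo_cvg T (F : set_system T) (FF : ProperFilter F) (g : T -> A) a :
  g @ F --> a -> (fun t => f (g t)) @ F --> f a.
Proof.
move=> ga; have g0 : (fun t => g t - a) @ F --> (0 : A).
  by rewrite -(subrr a); apply: cvgB => //; exact: cvg_cst.
apply: cvg_le_norm g0 _; apply: nearW => t.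
rewrite -(linearB_of flin); exact: corner_endo_contractive.
Qed.

(** For small [x], [1 - x^* x] is a square, so that
    [b^* x^* x b <= b^* b]. *)
Lemma hereditary_compress_pos b x : B b -> B (star b ** star x ** x ** b).
Proof.
(* [k] scales [x] down to the range of [quasi_sqrt] *)
move=> Bb; pose k : R[i] := (2 * (1 + `|x|))^-1.
have k0 : 0 < k by rewrite invr_gt0 mulr_gt0 // ltr_wpDr.
have kr : Num.conj k = k by rewrite conj_Creal // gtr0_real.
have [g gE] : exists g, g = star (k *: x) ** (k *: x) by exists (star (k *: x) ** (k *: x)).
have g4 : `|g| <= 4^-1.
  have kx : k * `|x| <= 2^-1.
    rewrite /k invfM -mulrA ler_piMr ?invr_ge0 ?ler0n //.
    by rewrite ler_pdivrMl ?mulr1 ?lerDr // ltr_wpDr.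
  rewrite gE cnorm_star normrZ gtr0_norm // [leRHS](_ : _ = 2^-1 ^+ 2); last by field.
  by rewrite ler_pXn2r // nnegrE ?mulr_ge0 ?invr_ge0 ?ler0n // ltW.
have gs : star g = g by rewrite gE !starE.
have [y [yy yS]] := quasi_sqrt g4.
have ys : star y = y.
  apply: (yS [set z | star z = z]) => [||z /= zs]; last 2 first.
  - exact: star0.
  - by rewrite !starE gs zs conj_Creal // realV realn.
  by apply: closed_equalizer => z; [apply: cvg_star|]; apply: cvg_id.
have Bg : B (star b ** g ** b).
  apply: (hereditary_le (corner_her fl) (b := star b ** b)).
  - by case: Bb => c _ <-; rewrite -fS -fM.
  - by exists (k *: x ** b); rewrite gE !(starE, cmulE).
  exists (b - y ** b); rewrite !(starE, cmulE) ys.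
  have -> : g = y + y - y ** y by rewrite yy addrK.
  by rewrite !cmulE; lin A; ring.
rewrite [X in B X](_ : _ = (k ^-2) *: (star b ** g ** b)); first exact: BZ.
rewrite gE !(starE, cmulE) !kr !scalerA -[LHS]scale1r; congr (_ *: _).
by field; rewrite gt_eqF.
Qed.

(** Polarization reaches the products [x^* z]; the approximate unit exhibits
    [a] as a limit of such products. *)
Lemma hereditary_compress b b' a : B b -> B b' -> B (b ** a ** b').
Proof.
have sq x z c : B c -> B (star c ** star x ** z ** c).
  move=> Bc; apply: (@polarization _ _ _ setT B (fun x z => star c ** star x ** z ** c)) => //.
  - by move=> ???; rewrite !(starE, cmulE).
  - by move=> ???; rewrite !(starE, cmulE).
  - by move=> ???; rewrite !(starE, cmulE).
  - by move=> ???; rewrite !(starE, cmulE).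
  by move=> ? _; exact: hereditary_compress_pos.
have diag c : B c -> B (star c ** a ** c).
  move=> Bc; apply: (closed_cvg _ (Defs.subalg_closed subB)
    (u_ := fun u => star c ** (u ** a) ** c) (F := approx_unit A)).
    apply: filterS approx_unit_star => u us; rewrite -us cmulA; exact: sq.
  by apply: cvg_cmulr; apply: cvg_cmull; exact: approx_unit_l.
move=> Bb Bb'; rewrite -(starK b).
apply: (@polarization _ _ _ B B (fun c c' => star c ** a ** c')) => //.
- by move=> ???; rewrite !(starE, cmulE).
- by move=> ???; rewrite !(starE, cmulE).
- by move=> ???; rewrite !(starE, cmulE).
- by move=> ???; rewrite !(starE, cmulE).
exact: (subalg_star subB).
Qed.

(** The expectation is a bimodule map over its range, and by heredity the
    compression of [a] is an element of that range. *)
Lemma exp_compress n a n' : f n ** f (l a) ** f n' = f n ** a ** f n'.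
Proof.
have E := corner_exp fl; have Bn := hereditary_compress a (Bf n) (Bf n').
rewrite -[RHS](condexp_id E Bn) /= -[f n ** a ** _]cmulA.
have /= -> := condexp_modl E (a ** f n') (Bf n).
by have /= -> := condexp_modr E a (Bf n'); rewrite cmulA.
Qed.

Lemma star_mul_star_eq0 d : d ** star d ** d = 0 -> d = 0.
Proof.
move=> h; apply: star_mul_eq0; apply: star_mul_eq0.
by rewrite starM starK -[LHS]cmulA [X in _ ** X]cmulA h cmul0r.
Qed.

(** The compressions of the defect by the corner vanish, and the defect lies
    in the corner. *)
Lemma exp_star a : f (l (star a)) = star (f (l a)).
Proof.
apply/eqP; rewrite -subr_eq0; apply/eqP.
pose d := l (star a) - star (l a).
rewrite -fS -(linearB_of flin) -/d.
have dn n n' : f n ** f d ** f n' = 0.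
  rewrite (linearB_of flin) fS !cmulE exp_compress.
  have := congr1 star (exp_compress (star n') a (star n)).
  by rewrite !starM !fS !starK !cmulA => ->; rewrite subrr.
apply: star_mul_star_eq0.
by have := congr1 star (dn (star d) (star d)); rewrite !fS !starM !starK cmulA star0.
Qed.

(** The defect [d] is killed by [f], hence [d] and its adjoint annihilate the
    range of [l], out of which [d] is built. *)
Lemma transfer_star a : l (star a) = star (l a).
Proof.
apply/eqP; rewrite -subr_eq0; apply/eqP; set d := _ - _.
have fd : f d = 0 by rewrite (linearB_of flin) exp_star fS subrr.
have dl b : d ** l b = 0 by rewrite -(corner_trans fl) fd cmul0l (linear0_of llin).
have dsl b : star d ** l b = 0.
  by rewrite -(corner_trans fl) fS fd star0 cmul0l (linear0_of llin).
apply: star_mul_star_eq0; rewrite -cmulA.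
have -> : star d ** d = - (l a ** d).
  rewrite {1}/d starB starK cmulDl cmulNl.
  by rewrite -[X in X - _]starK starM starK dsl star0 sub0r.
by rewrite cmulNr cmulA dl cmul0l oppr0.
Qed.

(** An element of the range of [l] that [f] kills annihilates this range, to
    which its adjoint belongs. *)
Lemma transfer_inj a b : f (l a) = f (l b) -> l a = l b.
Proof.
move=> e; apply/eqP; rewrite -subr_eq0 -(linearB_of llin); apply/eqP.
apply: mul_star_eq0; rewrite -transfer_star -(corner_trans fl).
by rewrite (linearB_of llin) (linearB_of flin) e subrr cmul0l (linear0_of llin).
Qed.

Lemma corner_transr a b : l (b ** f a) = l b ** a.
Proof.
by rewrite -[LHS]starK -transfer_star starM -fS (corner_trans fl) starM starK -transfer_star starK.
Qed.

Lemma exp_id a : f (l (f a)) = f a.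
Proof. by have /= -> := condexp_id (corner_exp fl) (Bf a). Qed.

Lemma transfer_exp a : l (f (l a)) = l a.
Proof. by apply: transfer_inj; rewrite exp_id. Qed.

(** On the range of [f], [l] is a homomorphism inverse to [f]. *)
Lemma transfer_contractive a : `|l a| <= `|a|.
Proof.
have /= := condexp_contractive (corner_exp fl) a; apply: le_trans.
rewrite -{1}transfer_exp; apply: (@hom_contractive _ _ B l) => //.
  move=> _ _ [b _ <-] [c _ <-]; rewrite (corner_trans fl).
  by rewrite -(corner_trans fl (l (f b))) exp_id (corner_trans fl).
by move=> b _; exact: transfer_star.
Qed.

(** Because [l] maps [x x^*] to a positive element [d^* d], the norm of
    [f n x] is controlled by that of [n d^*]. This replaces the factorization
    theorem in the proof of strict continuity. *)
Lemma endo_mul_bound x : exists c, forall n, `|f n ** x| <= `|n ** c|.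
Proof.
have [d dd] : cpositive (l (x ** star x)).
  by apply: (positive_map_pos (corner_pos fl)); exists (star x); rewrite starK.
exists (star d) => n; rewrite -[leLHS]norm_star -[leRHS]norm_star.
apply: ler_norm_star; rewrite !starK !starM !starK -!fS.
rewrite -[leRHS](_ : `|n ** (star d ** d) ** star n| = _); last by rewrite !cmulA.
rewrite -dd -[leLHS](_ : `|f n ** (x ** star x) ** f (star n)| = _); last by rewrite !cmulA.
by rewrite -exp_compress -!fM; exact: corner_endo_contractive.
Qed.

End Corner.

(** * Strict extension to multipliers *)

Section Multipliers.
Context {R : realType} {A : cstarAlgType R}.
Implicit Types (a b c x y : A) (m : multiplier A).

Lemma mulRM m a b : mulR m (a ** b) = a ** mulR m b.
Proof. by apply: cmul_injr => y; rewrite -mulLR -!cmulA mulLR. Qed.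

Lemma mulLM m a b : mulL m (a ** b) = mulL m a ** b.
Proof. by apply: cmul_injl => y; rewrite mulLR !cmulA mulLR. Qed.

Lemma mulR_linear m : linear (mulR m).
Proof.
by move=> k a b; apply: cmul_injr => y; rewrite -mulLR !cmulE -!mulLR.
Qed.

Lemma mulL_linear m : linear (mulL m).
Proof.
by move=> k a b; apply: cmul_injl => y; rewrite mulLR !cmulE -!mulLR.
Qed.

Lemma multiplier_eq m m' : mulL m = mulL m' -> mulR m = mulR m' -> m = m'.
Proof.
case: m m' => [p q pq] [p' q' pq'] /= ep eq; case: _ / ep in pq' *.
by case: _ / eq in pq' *; rewrite (Prop_irrelevance pq pq').
Qed.

Lemma multiplier_starLR m a b :
  a ** star (mulR m (star b)) = star (mulL m (star a)) ** b.
Proof. by rewrite -[LHS]starK starM starK -mulLR starM starK. Qed.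

Definition multiplier_star m := Multiplier (multiplier_starLR m).

Lemma strict_cvgP (F : set_system (multiplier A)) (FF : Filter F) m :
  F --> (m : strict_topology) <->
  (forall a, (mulL n a @[n --> F] --> mulL m a) /\
             (mulR n a @[n --> F] --> mulR m a)).
Proof.
split=> [Fm a|Fm].
  have eF : multiplier_eval n @[n --> F] --> multiplier_eval m.
    by apply: cvg_comp Fm _; exact: initial_continuous.
  split.
    have e1 : (fun n => (mulL n : {ptws A -> A})) @ F --> (mulL m : {ptws A -> A}).
      exact: (cvg_comp _ fst eF (@cvg_fst _ _ (nbhs (mulL m : {ptws A -> A}))
        (nbhs (mulR m : {ptws A -> A})) _)).
    by have /pointwise_cvgP := e1; apply.
  have e2 : (fun n => (mulR n : {ptws A -> A})) @ F --> (mulR m : {ptws A -> A}).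
    exact: (cvg_comp _ snd eF (@cvg_snd _ _ (nbhs (mulL m : {ptws A -> A}))
        (nbhs (mulR m : {ptws A -> A})) _)).
  by have /pointwise_cvgP := e2; apply.
have e1 : (fun n => (mulL n : {ptws A -> A})) @ F --> (mulL m : {ptws A -> A}).
  by apply/pointwise_cvgP => a; case: (Fm a).
have e2 : (fun n => (mulR n : {ptws A -> A})) @ F --> (mulR m : {ptws A -> A}).
  by apply/pointwise_cvgP => a; case: (Fm a).
have eF : multiplier_eval n @[n --> F] --> multiplier_eval m by exact: cvg_pair e1 e2.
move=> U /= [_ [[V Vop <-] Vm VU]].
apply: (@filterS _ F FF _ _ VU); apply: eF; exact: open_nbhs_nbhs.
Qed.

End Multipliers.

Section StrictExtension.
Context {R : realType} {A : cstarAlgType R} {f l : A -> A} (fl : corner f l).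
Implicit Types (a b c d x y n u : A) (m : multiplier A).

Let flin : linear f := star_endo_linear (corner_endo fl).
Let fM a b : f (a ** b) = f a ** f b := star_endoM (corner_endo fl) a b.
Let fS a : f (star a) = star (f a) := star_endo_star (corner_endo fl) a.
Local Notation AU := (approx_unit A).

(** The value at [x] of the extension of [f], obtained from [u m] tending
    strictly to [m]. *)
Definition extL m x : A := lim (f (mulR m u) ** x @[u --> AU]).

Lemma extL_cvg m x : f (mulR m u) ** x @[u --> AU] --> extL m x.
Proof.
have [c cx] := endo_mul_bound fl x.
have bd u u' : `|f (mulR m u) ** x - f (mulR m u') ** x| <= `|u ** mulL m c - u' ** mulL m c|.
  have -> : f (mulR m u) ** x - f (mulR m u') ** x = f (mulR m u - mulR m u') ** x.
    by rewrite (linearB_of flin) cmulDl cmulNl.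
  by apply: le_trans (cx _) _; rewrite cmulDl cmulNl -!mulLR.
have C : cauchy (f (mulR m u) ** x @[u --> AU]).
  apply: cauchy_exP => e e0; have e4 : 0 < e / 4 by rewrite divr_gt0.
  have /cvgrPdist_le /(_ _ e4) near_c := approx_unit_l (mulL m c).
  have [u0 hu0] := filter_ex near_c.
  exists (f (mulR m u0) ** x).
  change (\forall u \near AU, ball (f (mulR m u0) ** x) e (f (mulR m u) ** x)).
  apply: filterS near_c => u hu; rewrite -ball_normE /=.
  apply: le_lt_trans (bd _ _) _.
  have -> : u0 ** mulL m c - u ** mulL m c =
      (mulL m c - u ** mulL m c) - (mulL m c - u0 ** mulL m c) by lin A; ring.
  apply: le_lt_trans (ler_normB _ _) _; apply: le_lt_trans (lerD hu hu0) _.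
  rewrite -subr_gt0 [X in 0 < X](_ : _ = e / 2) ?divr_gt0 //.
  by field.
exact: (@cauchy_cvg A _ _ C).
Qed.

Lemma cvg_uniq T (F : set_system T) (FF : ProperFilter F) (g : T -> A) a b :
  g @ F --> a -> g @ F --> b -> a = b.
Proof. exact: (@cvg_unique _ (@norm_hausdorff _ A) (g @ F)). Qed.

(** Strict continuity of the extension: its value at [x] varies no more than
    the multiplier does at the single element [c]. *)
Lemma extL_dist m m' x c : (forall n, `|f n ** x| <= `|n ** c|) ->
  `|extL m x - extL m' x| <= `|mulL m c - mulL m' c|.
Proof.
move=> cx; have h1 : (fun u => f (mulR m u) ** x - f (mulR m' u) ** x) @ AU -->
    extL m x - extL m' x by apply: cvgB; exact: extL_cvg.
apply: (cvg_norm_le h1 (approx_unit_l (mulL m c - mulL m' c))).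
apply: nearW => u.
have -> : f (mulR m u) ** x - f (mulR m' u) ** x = f (mulR m u - mulR m' u) ** x.
  by rewrite (linearB_of flin) cmulDl cmulNl.
by apply: le_trans (cx _) _; rewrite cmulDl cmulNl -!mulLR cmulDr cmulNr.
Qed.

Lemma extLM m x y : extL m (x ** y) = extL m x ** y.
Proof.
apply: (cvg_uniq _ (@extL_cvg m (x ** y))).
have h : (fun u => (f (mulR m u) ** x) ** y) @ AU --> extL m x ** y.
  by apply: cvg_cmulr; exact: extL_cvg.
by apply: cvg_ext h => u; rewrite cmulA.
Qed.

(** [f n] times the limit is a limit again, of [f (n u m)]. *)
Lemma endo_extL m n x : f n ** extL m x = f (mulR m n) ** x.
Proof.
have [c cx] := endo_mul_bound fl x.
have h1 : (fun u => f n ** (f (mulR m u) ** x)) @ AU --> f n ** extL m x.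
  by apply: cvg_cmull; exact: extL_cvg.
apply: (cvg_uniq _ h1).
have h2 : (fun u => n ** (u ** mulL m c) - n ** mulL m c) @ AU --> (0 : A).
  rewrite -(subrr (n ** mulL m c)); apply: cvgB; last exact: cvg_cst.
  by apply: cvg_cmull; exact: approx_unit_l.
apply: cvg_le_norm h2 _; apply: nearW => u.
rewrite cmulA -fM -mulRM -cmulNl -cmulDl -(linearB_of flin).
apply: le_trans (cx _) _.
by rewrite cmulDl cmulNl -!mulLR cmulA.
Qed.

Definition extR m x : A := star (extL (multiplier_star m) (star x)).

Lemma extR_cvg m x : x ** f (mulL m u) @[u --> AU] --> extR m x.
Proof.
have h : (fun u => star (f (mulR (multiplier_star m) u) ** star x)) @ AU --> extR m x.
  by apply: cvg_star; exact: extL_cvg.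
apply: cvg_near_eq h; apply: filterS approx_unit_star => u us.
by rewrite starM starK -fS /= starK us.
Qed.

Lemma extRM m x y : extR m (y ** x) = y ** extR m x.
Proof. by rewrite /extR starM extLM starM starK. Qed.

Lemma extR_endo m n x : extR m x ** f n = x ** f (mulL m n).
Proof.
rewrite /extR -[f n]starK -starM -fS endo_extL starM starK -fS.
by rewrite /= !starK.
Qed.

Let p := multiplier1 : multiplier A.

Lemma extR_proj m a : extR m (extR p a) = extR m a.
Proof.
apply: (cvg_uniq _ (@extR_cvg m (extR p a))).
by apply: cvg_ext (@extR_cvg m a) => u; rewrite extR_endo.
Qed.

Lemma mul_extL m a b : a ** extL m b = extR p a ** extL m b.
Proof.
have h1 : (fun u => a ** (f u ** extL m b)) @ AU --> a ** extL m b.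
  apply: cvg_cmull; apply: cvg_ext (@extL_cvg m b) => u.
  by rewrite endo_extL.
apply: (cvg_uniq _ h1).
have h2 : (fun u => (a ** f u) ** extL m b) @ AU --> extR p a ** extL m b.
  by apply: cvg_cmulr; exact: (@extR_cvg p a).
by apply: cvg_ext h2 => u; rewrite cmulA.
Qed.

Lemma extR_fixed m a : extR m a ** f u @[u --> AU] --> extR m a.
Proof.
by apply: cvg_ext (@extR_cvg m a) => u; rewrite extR_endo.
Qed.

Lemma corner_compress_range a y : a ** f u @[u --> AU] --> a ->
  y ** f u @[u --> AU] --> y -> range f (star y ** a).
Proof.
move=> ha hy.
have h : (fun u => star (y ** f u) ** (a ** f u)) @ AU --> star y ** a.
  by apply: cvg_cmul ha; apply: cvg_star.
apply: (closed_cvg _ (Defs.subalg_closed (hereditary_subalg (corner_her fl))) _ _ h).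
apply: nearW => u; rewrite starM -fS.
have -> : f (star u) ** star y ** (a ** f u) = f (star u) ** (star y ** a) ** f u by rewrite !cmulA.
by apply: (hereditary_compress fl); [exists (star u)|exists u].
Qed.

(** Both sides agree when [a] is replaced by an element [f k] of the corner;
    the general case is tested against [a] and [extR m a], whose adjoints carry
    [a] into the corner. *)
Lemma ext_multiplier m a b : a ** extL m b = extR m a ** b.
Proof.
rewrite mul_extL -(extR_proj m).
have : extR p a ** f u @[u --> AU] --> extR p a.
  by apply: cvg_ext (@extR_cvg p a) => u; rewrite extR_endo.
move: (extR p a) => {}a ha; apply/eqP; rewrite -subr_eq0; apply/eqP.
set d := _ - _.
have test y : y ** f u @[u --> AU] --> y -> star y ** d = 0.
  move=> hy; have [k _ fk] := corner_compress_range ha hy.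
  rewrite /d cmulDr cmulNr !cmulA -extRM -fk endo_extL.
  suff -> : extR m (f k) = f (mulR m k) by rewrite subrr.
  apply: (cvg_uniq _ (@extR_cvg m (f k))).
  have h : (fun u => f (mulR m k ** u)) @ AU --> f (mulR m k).
    by apply: (corner_endo_cvg fl); exact: approx_unit_r.
  by apply: cvg_ext h => u; rewrite -mulLR fM.
apply: star_mul_eq0; rewrite {1}/d starB !starM cmulDl cmulNl -!cmulA.
by rewrite (test _ ha) (test _ (@extR_fixed m a)) !cmul0r subrr.
Qed.

Definition ext m : multiplier A := Multiplier (ext_multiplier m).

Lemma ext_strict : strict_extension f ext.
Proof.
split=> [m|a].
  have NF : ProperFilter (nbhs (m : strict_topology)).
    exact: (@nbhs_pfilter strict_topology m).
  have FF : Filter (ext n @[n --> (m : strict_topology)]).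
    exact: (@fmap_filter _ _ ext _ NF).
  apply/strict_cvgP => x; split.
    have [c cx] := endo_mul_bound fl x.
    have h : (fun q => mulL q c - mulL m c) @ nbhs (m : strict_topology) --> (0 : A).
      rewrite -(subrr (mulL m c)); apply: cvgB; last exact: cvg_cst.
      have : nbhs (m : strict_topology) --> (m : strict_topology) by [].
      by move/strict_cvgP => /(_ c)[].
    by apply: cvg_le_norm h _; apply: nearW => q; exact: extL_dist.
  have [c cx] := endo_mul_bound fl (star x).
  have h : (fun q => star (mulR q (star c)) - star (mulR m (star c))) @
      nbhs (m : strict_topology) --> (0 : A).
    rewrite -(subrr (star (mulR m (star c)))); apply: cvgB; last exact: cvg_cst.
    apply: cvg_star.
    have : nbhs (m : strict_topology) --> (m : strict_topology) by [].
    by move/strict_cvgP => /(_ (star c))[].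
  apply: cvg_le_norm h _; apply: nearW => q /=.
  rewrite /extR -starB norm_star.
  exact: (@extL_dist (multiplier_star q) (multiplier_star m)).
have eL y x : extL (multiplier_of y) x = f y ** x.
  apply: (cvg_uniq _ (@extL_cvg _ x)); apply: cvg_cmulr => /=.
  by apply: (corner_endo_cvg fl); exact: approx_unit_l.
apply: multiplier_eq; apply/funext => x /=; first exact: eL.
have -> : extR (multiplier_of a) x = star (extL (multiplier_of (star a)) (star x)).
  rewrite /extR; congr (star (extL _ _)); apply: multiplier_eq; apply/funext => y /=.
    by rewrite starM starK.
  by rewrite starM starK.
by rewrite eL fS starM !starK.
Qed.

(** The unit is the strict limit of the approximate unit, hence every strict
    extension of [f] sends it to the limit of [f u]. *)
Lemma strict_ext_unit x :
  (f u ** x @[u --> AU] --> mulL (strict_ext f multiplier1) x) /\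
  (x ** f u @[u --> AU] --> mulR (strict_ext f multiplier1) x).
Proof.
have : strict_extension f (strict_ext f).
  by rewrite /strict_ext; apply: xgetPex; exists ext; exact: ext_strict.
move: (strict_ext f) => F [Fc Fe].
have h : (multiplier_of u : strict_topology) @[u --> AU] --> (multiplier1 : strict_topology).
  have FF : Filter (multiplier_of u @[u --> AU]) by exact: (@fmap_filter _ _ _ AU).
  by apply/strict_cvgP => y; split; [exact: approx_unit_l|exact: approx_unit_r].
have h2 : (F (multiplier_of u) : strict_topology) @[u --> AU] -->
   (F multiplier1 : strict_topology) by exact: (cvg_comp _ _ h (Fc multiplier1)).
have e : (fun u => F (multiplier_of u)) = (fun u => multiplier_of (f u)).
  by apply/funext => u; rewrite Fe.
rewrite e in h2.
have FF : Filter (multiplier_of (f u) @[u --> AU]) by exact: (@fmap_filter _ _ _ AU).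
by have /strict_cvgP /(_ x) [] := h2.
Qed.

End StrictExtension.

(** * Closed subspaces as Banach spaces *)

Section ClosedSubspaces.
Context {R : realType} {V : completeNormedModType R[i]}.

Record closedSubspace := ClosedSubspace {
  subspace_pred :> {pred V};
  subspace_submod : GRing.submod_closed subspace_pred;
  subspace_closed : closed [set x | x \in subspace_pred]
}.

Variable W : closedSubspace.

HB.instance Definition _ :=
  GRing.isSubmodClosed.Build R[i] V (subspace_pred W) (subspace_submod W).

Definition subspace_type := {x : V | x \in subspace_pred W}.
HB.instance Definition _ := SubChoice.on subspace_type.
HB.instance Definition _ := [SubChoice_isSubLmodule of subspace_type by <:].

Definition subspace_norm (x : subspace_type) : R[i] := `|val x|.

Lemma subspace_normD x y :
  subspace_norm (x + y) <= subspace_norm x + subspace_norm y.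
Proof. exact: ler_normD. Qed.

Lemma subspace_normZ (k : R[i]) x :
  subspace_norm (k *: x) = `|k| * subspace_norm x.
Proof. exact: normrZ. Qed.

Lemma subspace_norm_eq0 x : subspace_norm x = 0 -> x = 0.
Proof. by move/eqP; rewrite normr_eq0 => /eqP x0; apply/val_inj. Qed.

HB.instance Definition _ := Lmodule_isNormed.Build R[i] subspace_type
  subspace_normD subspace_normZ subspace_norm_eq0.

Lemma subspace_normE (x : subspace_type) : `|x| = `|val x|.
Proof. by []. Qed.

Lemma subspace_complete (F : set_system subspace_type) :
  ProperFilter F -> cauchy F -> cvg F.
Proof.
move=> FF FC.
have vC : cauchy (val x @[x --> F]).
  apply/cauchy_ballP => e e0; have /cauchy_ballP /(_ e e0) := FC.
  rewrite !near_simpl => -[P [P1 P2] PE].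
  exists (val @` P.1, val @` P.2) => /=.
    split; [apply: filterS P1|apply: filterS P2] => x Px; by exists x.
  move=> [_ _] /= [[x Px <-] [y Py <-]].
  have := PE (x, y) (conj Px Py); by rewrite -!ball_normE.
have [l lF] : exists l : V, val x @[x --> F] --> l.
  by exists (lim (val x @[x --> F])); exact: (@cauchy_cvg V _ _ vC).
have lW : l \in subspace_pred W.
  suff : [set x | x \in subspace_pred W] l by [].
  apply: (closed_cvg _ (subspace_closed (c := W)) _ _ lF).
  by apply: nearW => x; exact: (valP x).
apply: (@cvgP _ F (Sub l lW : subspace_type)).
have fl : (fun x : subspace_type => x) @ F --> (Sub l lW : subspace_type).
  apply/cvgrPdist_lt => e e0; have /cvgrPdist_lt /(_ e e0) := lF.
  apply: filterS => x; by rewrite subspace_normE.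
exact: fl.
Qed.

HB.instance Definition _ := Uniform_isComplete.Build subspace_type subspace_complete.

Definition subspace_space : completeNormedModType R[i] := subspace_type.

End ClosedSubspaces.

(** * The multiplication of a corner system *)

Section CornerSystems.
Context {R : realType} {G : zmodType} {A : cstarAlgType R}.
Context {Gpos : set G} {alpha L : G -> A -> A}.
Hypotheses (hG : positive_cone Gpos) (hA : corner_system Gpos alpha L).
Implicit Types (g h k s t : G) (a b c x y u : A).

Local Notation AU := (approx_unit A).
Local Notation pL t := (mulL (corner_proj alpha t)).
Local Notation pR t := (mulR (corner_proj alpha t)).

Lemma corner_system_corner t : Gpos t -> corner (alpha t) (L t).
Proof.
move=> ht; split; [exact: (corner_alpha_endo hA)|exact: (corner_L_pos hA)|
  move=> a b; exact: (corner_transfer hA)|exact: (corner_hereditary hA)|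
  exact: (corner_condexp hA)].
Qed.

Let alphaM t a b (ht : Gpos t) : alpha t (a ** b) = alpha t a ** alpha t b :=
  star_endoM (corner_alpha_endo hA ht) a b.
Let alphaS t a (ht : Gpos t) : alpha t (star a) = star (alpha t a) :=
  star_endo_star (corner_alpha_endo hA ht) a.
Let alpha_lin t (ht : Gpos t) : linear (alpha t) :=
  star_endo_linear (corner_alpha_endo hA ht).
Let L_lin t (ht : Gpos t) : linear (L t) :=
  positive_map_linear (corner_L_pos hA ht).
Let LM t a b (ht : Gpos t) : L t (alpha t a ** b) = a ** L t b :=
  corner_transfer hA a b ht.
Let LMr t a b (ht : Gpos t) : L t (a ** alpha t b) = L t a ** b :=
  corner_transr (corner_system_corner ht) b a.
Let LS t a (ht : Gpos t) : L t (star a) = star (L t a) :=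
  transfer_star (corner_system_corner ht) a.

Lemma projL_cvg t x : Gpos t -> alpha t u ** x @[u --> AU] --> pL t x.
Proof. by move=> /corner_system_corner/strict_ext_unit/(_ x)[]. Qed.

Lemma projR_cvg t x : Gpos t -> x ** alpha t u @[u --> AU] --> pR t x.
Proof. by move=> /corner_system_corner/strict_ext_unit/(_ x)[]. Qed.

Lemma proj_star t x : Gpos t -> star (pL t x) = pR t (star x).
Proof.
move=> ht; have h : (fun u => star (alpha t u ** x)) @ AU --> star (pL t x).
  by apply: cvg_star; exact: projL_cvg.
apply: (cvg_uniq _ h); have := @projR_cvg t (star x) ht; apply: cvg_near_eq.
apply: filterS approx_unit_star => u us.
by rewrite starM -alphaS // us.
Qed.

Lemma proj_star_fixed t a : Gpos t -> pL t a = a <-> pR t (star a) = star a.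
Proof.
by move=> ht; rewrite -proj_star //; split=> [->//|/(congr1 star)]; rewrite !starK.
Qed.

Lemma projL_endo t a : Gpos t -> pL t (alpha t a) = alpha t a.
Proof.
move=> ht; have h := @projL_cvg t (alpha t a) ht.
apply: (cvg_uniq _ h); have h2 : (fun u => alpha t (u ** a)) @ AU --> alpha t a.
  by apply: (corner_endo_cvg (corner_system_corner ht)); exact: approx_unit_l.
by apply: cvg_ext h2 => u; rewrite alphaM.
Qed.

Lemma projR_endo t a : Gpos t -> pR t (alpha t a) = alpha t a.
Proof.
by move=> ht; have /(proj_star_fixed _ ht) := projL_endo (star a) ht; rewrite -alphaS // starK.
Qed.

(** [alpha (s + t)] takes its values in the range of [alpha s], on which the
    projection of [s] is the identity; the projections decrease. *)
Lemma projL_absorb s t x : Gpos s -> Gpos t -> pL (s + t) (pL s x) = pL (s + t) x.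
Proof.
move=> hs ht; have hst := coneD hG hs ht.
have h := @projL_cvg _ (pL s x) hst; apply: (cvg_uniq _ h).
apply: cvg_ext (@projL_cvg _ x hst) => u.
by rewrite mulLR (corner_alphaD hA) // projR_endo.
Qed.

Lemma projR_absorb s t x : Gpos s -> Gpos t -> pR s (pR (s + t) x) = pR (s + t) x.
Proof.
by move=> hs ht; apply: cmul_injr => y; rewrite -!mulLR projL_absorb.
Qed.

Lemma projR_idem t x : Gpos t -> pR t (pR t x) = pR t x.
Proof. by move=> ht; have := projR_absorb x ht (cone0 hG); rewrite addr0. Qed.

Lemma projL_idem t x : Gpos t -> pL t (pL t x) = pL t x.
Proof. by move=> ht; have := projL_absorb x ht (cone0 hG); rewrite addr0. Qed.

Lemma projR_le s t x : Gpos s -> Gpos t -> pR (s + t) x = x -> pR s x = x.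
Proof. by move=> hs ht <-; exact: projR_absorb. Qed.

Lemma projL_le s t x : Gpos s -> Gpos t -> pL (s + t) x = x -> pL s x = x.
Proof.
move=> hs ht /(proj_star_fixed _ (coneD hG hs ht)) => hx.
by apply/(proj_star_fixed _ hs); exact: projR_le hx.
Qed.

Lemma proj0 x : pR 0 x = x /\ pL 0 x = x.
Proof.
by split; rewrite -[in LHS](corner_alpha0 hA x) ?projR_endo ?projL_endo ?(corner_alpha0 hA) //;
  exact: cone0.
Qed.

(** Strict continuity extends the multiplicativity of [alpha s] from
    [x ** alpha t u] to the limit. *)
Lemma endo_projR s t x : Gpos s -> Gpos t ->
  alpha s (pR t x) = pR (s + t) (alpha s x).
Proof.
move=> hs ht; have h := @projR_cvg _ (alpha s x) (coneD hG hs ht).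
symmetry; apply: (cvg_uniq _ h).
have h2 : (fun u => alpha s (x ** alpha t u)) @ AU --> alpha s (pR t x).
  by apply: (corner_endo_cvg (corner_system_corner hs)); exact: projR_cvg.
by apply: cvg_ext h2 => u; rewrite alphaM // (corner_alphaD hA).
Qed.

Lemma transfer_cvg T (F : set_system T) (FF : ProperFilter F) t (g : T -> A) a :
  Gpos t -> g @ F --> a -> (fun i => L t (g i)) @ F --> L t a.
Proof.
move=> ht ga; have g0 : (fun i => g i - a) @ F --> (0 : A).
  by rewrite -(subrr a); apply: cvgB => //; exact: cvg_cst.
apply: cvg_le_norm g0 _; apply: nearW => i.
rewrite -(linearB_of (L_lin ht)).
exact: (transfer_contractive (corner_system_corner ht)).
Qed.

(** Likewise for the module property of [L s]. *)
Lemma transfer_projR s t x : Gpos s -> Gpos t ->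
  L s (pR (s + t) x) = pR t (L s x).
Proof.
move=> hs ht; have h := @projR_cvg _ (L s x) ht.
symmetry; apply: (cvg_uniq _ h).
have h2 : (fun u => L s (x ** alpha (s + t) u)) @ AU --> L s (pR (s + t) x).
  by apply: transfer_cvg => //; apply: projR_cvg; exact: coneD.
by apply: cvg_ext h2 => u; rewrite (corner_alphaD hA) // LMr.
Qed.

(** Both sides have the same compressions by the range of [alpha t], and
    neither changes under the projection. *)
Lemma endo_transfer t x : Gpos t -> alpha t (L t x) = pL t (pR t x).
Proof.
move=> ht; have fl := corner_system_corner ht.
have e1 n : alpha t (L t x) ** alpha t n = pL t x ** alpha t n.
  have h := @projL_cvg _ (alpha t (L t x) ** alpha t n) ht.
  rewrite -alphaM // projL_endo // alphaM // in h.
  apply: (cvg_uniq _ h); have := @projL_cvg _ (x ** alpha t n) ht.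
  rewrite mulLM; apply: cvg_ext => u.
  by rewrite !cmulA (exp_compress fl).
have : pR t (alpha t (L t x)) = pR t (pL t x).
  apply: cmul_injr => y; rewrite -!mulLR.
  have h (z : A) : z ** (alpha t u ** y) @[u --> AU] --> z ** pL t y.
    by apply: cvg_cmull; exact: projL_cvg.
  apply: (cvg_uniq _ (h (alpha t (L t x)))).
  by apply: cvg_ext (h (pL t x)) => u; rewrite !cmulA e1.
rewrite projR_endo // => ->.
by apply: cmul_injr => y; rewrite -mulLR -!mulLM -mulLR.
Qed.

Lemma projLE t x : Gpos t -> pL t x = star (pR t (star x)).
Proof. by move=> ht; rewrite -proj_star // starK. Qed.

Local Notation mul := (corner_mul Gpos alpha L).
Local Notation fib := (corner_fiber Gpos alpha).

Lemma cone_eq0 t : Gpos t -> Gpos (- t) -> t = 0.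
Proof. exact: (cone_antisym hG). Qed.

Lemma fiber_pos g a : Gpos g -> fib g a <-> pR g a = a.
Proof.
move=> hg; rewrite /corner_fiber mem_set //; split=> [[x _ <-]|<-]; last by exists a.
exact: projR_idem.
Qed.

Lemma fiber_neg g a : Gpos (- g) -> fib g a <-> pL (- g) a = a.
Proof.
move=> hg; have [hg'|hg'] := pselect (Gpos g).
  rewrite fiber_pos // (cone_eq0 hg' hg) oppr0.
  by split=> _; case: (proj0 a).
rewrite /corner_fiber memNset //; split=> [[x _ <-]|<-]; last by exists a.
exact: projL_idem.
Qed.

(** The six formulas of the multiplication agree where their domains meet, so
    that each can be used with non-strict inequalities. *)
Lemma mul_pp g h a b : Gpos g -> Gpos h -> mul g h a b = a ** alpha g b.
Proof. by move=> hg hh; rewrite /corner_mul !mem_set. Qed.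

Lemma cone_sum g s t : Gpos s -> Gpos t -> s + t = g -> Gpos g.
Proof. by move=> hs ht <-; exact: coneD. Qed.

Lemma mul_np_p g h a b : Gpos (- g) -> Gpos (g + h) ->
  mul g h a b = L (- g) (a ** b).
Proof.
move=> hg hgh; have hh : Gpos h by apply: (cone_sum hg hgh); zlin G.
rewrite /corner_mul; have [hg'|hg'] := pselect (Gpos g).
  have g0 := cone_eq0 hg' hg; subst g.
  by rewrite !mem_set // oppr0 (corner_L0 hA) (corner_alpha0 hA).
by rewrite memNset // !mem_set.
Qed.

Lemma mul_np_n g h a b : Gpos h -> Gpos (- (g + h)) -> mul g h a b = L h (a ** b).
Proof.
move=> hh hgh; have hg : Gpos (- g) by apply: (cone_sum hh hgh); zlin G.
have [hgh'|hgh'] := pselect (Gpos (g + h)).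
  rewrite mul_np_p //; congr (L _ _); apply/eqP; rewrite eq_sym -addr_eq0 addrC.
  exact/eqP/cone_eq0.
rewrite /corner_mul (memNset hgh') (mem_set hh) memNset // => hg'.
by apply: hgh'; exact: coneD.
Qed.

Lemma mul_pn_p g h a b : Gpos (- h) -> Gpos (g + h) ->
  mul g h a b = a ** alpha (g + h) b.
Proof.
move=> hh hgh; have hg : Gpos g by apply: (cone_sum hh hgh); zlin G.
rewrite /corner_mul mem_set //; have [hh'|hh'] := pselect (Gpos h).
  have h0 := cone_eq0 hh' hh; subst h.
  by rewrite mem_set // addr0.
by rewrite memNset // mem_set.
Qed.

Lemma mul_pn_n g h a b : Gpos g -> Gpos (- (g + h)) ->
  mul g h a b = alpha (- (g + h)) a ** b.
Proof.
move=> hg hgh; have hh : Gpos (- h) by apply: (cone_sum hg hgh); zlin G.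
have [hgh'|hgh'] := pselect (Gpos (g + h)).
  by rewrite mul_pn_p // (cone_eq0 hgh' hgh) oppr0 !(corner_alpha0 hA).
rewrite /corner_mul (mem_set hg) (memNset hgh') memNset ?opprD // => hh'.
by apply: hgh'; exact: coneD.
Qed.

Lemma mul_nn g h a b : Gpos (- g) -> Gpos (- h) ->
  mul g h a b = alpha (- h) a ** b.
Proof.
move=> hg hh; have [hg'|hg'] := pselect (Gpos g).
  have g0 := cone_eq0 hg' hg; subst g.
  by rewrite mul_pn_n // ?add0r.
have [hh'|hh'] := pselect (Gpos h); last by rewrite /corner_mul !memNset.
have h0 := cone_eq0 hh' hh; subst h.
by rewrite mul_np_n ?addr0 // oppr0 (corner_L0 hA) (corner_alpha0 hA).
Qed.

(** Exchanges the signs of the two degrees, which halves the case analyses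
    that follow. *)
Lemma mul_star g h a b :
  star (mul g h a b) = mul (- h) (- g) (star b) (star a).
Proof.
have [hg|hg] := cone_total hG g; have [hh|hh] := cone_total hG h.
- by rewrite mul_pp // mul_nn ?opprK // starM alphaS.
- have [hgh|hgh] := cone_total hG (g + h).
    rewrite mul_pn_p // starM -alphaS //.
    rewrite mul_pn_n //; last by rewrite -opprD opprK addrC.
    by rewrite -opprD opprK addrC.
  rewrite mul_pn_n // starM -alphaS // mul_pn_p ?opprK //; last by rewrite -opprD addrC.
  by rewrite -opprD addrC.
- have [hgh|hgh] := cone_total hG (g + h).
    rewrite mul_np_p // -LS // starM mul_np_n //.
    by rewrite -opprD opprK addrC.
  rewrite mul_np_n // -LS // starM mul_np_p ?opprK //.
  by rewrite -opprD addrC.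
by rewrite mul_nn // starM -alphaS // mul_pp.
Qed.

Lemma fiber_star g a : fib g a -> fib (- g) (star a).
Proof.
have [hg|hg] := cone_total hG g.
  rewrite fiber_pos // fiber_neg ?opprK // => ha.
  by apply/proj_star_fixed => //; rewrite starK.
by rewrite fiber_neg // fiber_pos // => /proj_star_fixed ->.
Qed.

Lemma fiber_mul g h a b : fib g a -> fib h b -> fib (g + h) (mul g h a b).
Proof.
have pos g' h' a' b' : Gpos (g' + h') -> fib h' b' -> fib (g' + h') (mul g' h' a' b').
  move=> hgh hb; apply/fiber_pos => //.
  have [hg|hg] := cone_total hG g'.
    have [hh|hh] := cone_total hG h'; last by rewrite mul_pn_p // mulRM projR_endo.
    by move/fiber_pos: hb => /(_ hh) hb; rewrite mul_pp // mulRM -endo_projR // hb.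
  have hh : Gpos h' by apply: (cone_sum hg hgh); zlin G.
  move/fiber_pos: hb => /(_ hh) hb.
  rewrite mul_np_p // -transfer_projR //.
  have -> : - g' + (g' + h') = h' by zlin G.
  by rewrite mulRM hb.
(* negative degrees follow by taking adjoints *)
move=> ha hb; have [hgh|hgh] := cone_total hG (g + h); first exact: pos.
rewrite -[mul _ _ _ _]starK -[g + h]opprK; apply: fiber_star.
rewrite mul_star; have e : - (g + h) = - h - g by zlin G.
by rewrite e in hgh *; apply: pos => //; exact: fiber_star.
Qed.

Lemma mul_norm g h a b : `|mul g h a b| <= `|a| * `|b|.
Proof.
have al t x y z : Gpos t -> z = x ** alpha t y -> `|z| <= `|x| * `|y|.
  move=> ht ->; apply: le_trans (cnormM _ _) _; apply: ler_wpM2l => //.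
  exact: (corner_endo_contractive (corner_system_corner ht)).
have ar t x y z : Gpos t -> z = alpha t x ** y -> `|z| <= `|x| * `|y|.
  move=> ht ->; apply: le_trans (cnormM _ _) _; apply: ler_wpM2r => //.
  exact: (corner_endo_contractive (corner_system_corner ht)).
have tr t x y z : Gpos t -> z = L t (x ** y) -> `|z| <= `|x| * `|y|.
  move=> ht ->; apply: le_trans (cnormM _ _).
  exact: (transfer_contractive (corner_system_corner ht)).
have [hg|hg] := cone_total hG g; have [hh|hh] := cone_total hG h.
- by apply: (al _ _ _ _ hg); rewrite mul_pp.
- have [hgh|hgh] := cone_total hG (g + h).
    by apply: (al _ _ _ _ hgh); rewrite mul_pn_p.
  by apply: (ar _ _ _ _ hgh); rewrite mul_pn_n.
- have [hgh|hgh] := cone_total hG (g + h).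
    by apply: (tr _ _ _ _ hg); rewrite mul_np_p.
  by apply: (tr _ _ _ _ hh); rewrite mul_np_n.
by apply: (ar _ _ _ _ hh); rewrite mul_nn.
Qed.

Lemma mul_linearl g h b : linear (fun a => mul g h a b).
Proof.
move=> k a a'; have [hg|hg] := cone_total hG g; have [hh|hh] := cone_total hG h.
- by rewrite !mul_pp // !cmulE.
- have [hgh|hgh] := cone_total hG (g + h); first by rewrite !mul_pn_p // !cmulE.
  by rewrite !mul_pn_n // (alpha_lin hgh) !cmulE.
- have [hgh|hgh] := cone_total hG (g + h).
    by rewrite !mul_np_p // !cmulE (L_lin hg).
  by rewrite !mul_np_n // !cmulE (L_lin hh).
by rewrite !mul_nn // (alpha_lin hh) !cmulE.
Qed.

Lemma mul_linearr g h a : linear (mul g h a).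
Proof.
move=> k b b'; rewrite -[LHS]starK mul_star starD starZ mul_linearl.
by rewrite starD starZ conjCK !mul_star !opprK !starK.
Qed.

(** For [g] in the cone, [L g] does not increase the norm of [a^* a], and it
    does not decrease it because [alpha g] maps the image back to
    [p a^* a p = a^* a]. *)
Lemma mul_cstar_pos g a : fib g a ->
  cpositive (mul (- g) g (star a) a) /\ `|mul (- g) g (star a) a| = `|a| ^+ 2.
Proof.
move=> ha; have h0 : Gpos (- g + g) by rewrite addNr; exact: cone0.
have [hg|hg] := cone_total hG g; last first.
  rewrite mul_pn_p // addNr (corner_alpha0 hA) cnorm_star; split=> //.
  by exists a.
rewrite mul_np_p ?opprK //; split.
  by apply: (positive_map_pos (corner_L_pos hA hg)); exists a.
move/fiber_pos: ha => /(_ hg) ha; rewrite -cnorm_star; apply: le_anti.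
have fl := corner_system_corner hg; apply/andP; split.
  exact: transfer_contractive fl _.
have := corner_endo_contractive fl (L g (star a ** a)).
by rewrite endo_transfer // mulRM ha mulLM projLE // starK ha.
Qed.

Local Notation assoc g h k a b c :=
  (mul g (h + k) a (mul h k b c) = mul (g + h) k (mul g h a b) c).

(** Leaves four of the eight sign patterns. *)
Lemma assoc_star g h k a b c :
  assoc (- k) (- h) (- g) (star c) (star b) (star a) -> assoc g h k a b c.
Proof.
move/(congr1 star); rewrite !mul_star !opprD !opprK !starK.
by rewrite [k + h]addrC [h + g]addrC => ->.
Qed.

Lemma assoc_ppp g h k a b c : Gpos g -> Gpos h -> Gpos k -> assoc g h k a b c.
Proof.
move=> hg hh hk; have hgh := coneD hG hg hh; have hhk := coneD hG hh hk.
by rewrite !mul_pp // alphaM // (corner_alphaD hA) // cmulA.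
Qed.

Lemma assoc_ppn g h k a b c : Gpos g -> Gpos h -> Gpos (- k) -> assoc g h k a b c.
Proof.
move=> hg hh hk; have hgh := coneD hG hg hh; rewrite [mul g h _ _]mul_pp //.
have [hhk|hhk] := cone_total hG (h + k).
  have hghk : Gpos (g + h + k) by apply: (cone_sum hg hhk); zlin G.
  rewrite [mul h k _ _]mul_pn_p // [RHS]mul_pn_p // mul_pp //.
  by rewrite alphaM // -addrA -(corner_alphaD hA) // cmulA.
rewrite [mul h k _ _]mul_pn_n //; have [hghk|hghk] := cone_total hG (g + h + k).
  rewrite [RHS]mul_pn_p // mul_pn_p ?addrA // alphaM // -(corner_alphaD hA) // cmulA.
  by have -> : g + h + k - (h + k) = g by zlin G.
rewrite [RHS]mul_pn_n // mul_pn_n ?addrA // alphaM // -(corner_alphaD hA) // cmulA.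
by have -> : - (g + h + k) + g = - (h + k) by zlin G.
Qed.

Lemma assoc_npp g h k a b c : Gpos (- g) -> Gpos h -> Gpos k -> assoc g h k a b c.
Proof.
move=> hg hh hk; have hhk := coneD hG hh hk; rewrite [mul h k _ _]mul_pp //.
have [hgh|hgh] := cone_total hG (g + h).
  have hghk : Gpos (g + (h + k)) by apply: (cone_sum hgh hk); zlin G.
  rewrite [mul g h _ _]mul_np_p // [RHS]mul_pp // mul_np_p //.
  rewrite -LMr // -(corner_alphaD hA) // cmulA.
  by have -> : - g + (g + h) = h by zlin G.
rewrite [mul g h _ _]mul_np_n //; have [hghk|hghk] := cone_total hG (g + h + k).
  rewrite [RHS]mul_np_p // mul_np_p ?addrA // -LMr // -(corner_LD hA) // cmulA.
  by have -> : - (g + h) + h = - g by zlin G.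
rewrite [RHS]mul_np_n // mul_np_n ?addrA // -LMr // -(corner_LD hA) // cmulA.
by rewrite addrC.
Qed.

(** The projections produced by [alpha t (L t x)] are absorbed by [a], [b] and
    [c], because these lie in their fibers. *)
Lemma assoc_pnp g h k a b c : Gpos g -> Gpos (- h) -> Gpos k ->
  fib g a -> fib h b -> fib k c -> assoc g h k a b c.
Proof.
move=> hg hh hk /(fiber_pos _ hg) fa /(fiber_neg _ hh) fb /(fiber_pos _ hk) fc.
have [hgh|hgh] := cone_total hG (g + h); have [hhk|hhk] := cone_total hG (h + k).
- rewrite [mul h k _ _]mul_np_p // [mul g h _ _]mul_pn_p // !mul_pp // -cmulA -alphaM //.
  have eg : g = (g + h) - h by zlin G.
  rewrite {1}eg (corner_alphaD hA) // endo_transfer // mulRM mulLM fb.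
  rewrite (@projR_le (- h) (h + k)) //.
  by have -> : - h + (h + k) = k by zlin G.
- rewrite [mul h k _ _]mul_np_n // [mul g h _ _]mul_pn_p // [RHS]mul_pp // -cmulA -alphaM //.
  have pos : Gpos (g + (h + k)) by apply: (cone_sum hgh hk); zlin G.
  rewrite mul_pn_p // addrA [alpha (g + h + k) _](corner_alphaD hA) // endo_transfer // mulRM fc mulLM.
  rewrite (@projL_le k (- (h + k))) //.
  by have -> : k - (h + k) = - h by zlin G.
- have pos : Gpos (g + h + k) by apply: (cone_sum hg hhk); zlin G.
  rewrite [mul h k _ _]mul_np_p // [mul g h _ _]mul_pn_n // mul_pp // mul_np_p //.
  rewrite -cmulA LM //.
  have -> : L (- h) (b ** c) = L g (L (- (g + h)) (b ** c)).
    by rewrite -(corner_LD hA) //; congr (L _ _); zlin G.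
  rewrite endo_transfer // mulLR fa -transfer_projR //.
  have -> : - (g + h) + g = - h by zlin G.
  rewrite mulRM (@projR_le (- h) (h + k)) //.
  by have -> : - h + (h + k) = k by zlin G.
rewrite [mul h k _ _]mul_np_n // [mul g h _ _]mul_pn_n //.
have [pos|neg] := cone_total hG (g + h + k).
  rewrite mul_pn_p // ?addrA // mul_np_p // -cmulA LM //.
  have -> : L k (b ** c) = L (g + h + k) (L (- (g + h)) (b ** c)).
    by rewrite -(corner_LD hA) //; congr (L _ _); zlin G.
  rewrite endo_transfer // mulLR (@projR_le (g + h + k) (- (h + k))) //; last first.
    by have -> : g + h + k - (h + k) = g by zlin G.
  rewrite -transfer_projR //.
  have -> : - (g + h) + (g + h + k) = k by zlin G.
  by rewrite mulRM fc.
rewrite mul_pn_n ?addrA // mul_np_n // -cmulA.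
have -> : - (g + h) = k - (g + h + k) by zlin G.
by rewrite (corner_alphaD hA) // LM.
Qed.

Lemma mul_assoc g h k a b c : fib g a -> fib h b -> fib k c -> assoc g h k a b c.
Proof.
move=> fa fb fc.
have [hg|hg] := cone_total hG g; have [hh|hh] := cone_total hG h;
  have [hk|hk] := cone_total hG k.
- exact: assoc_ppp.
- exact: assoc_ppn.
- exact: assoc_pnp.
- by apply: assoc_star; apply: assoc_ppn; rewrite ?opprK.
- exact: assoc_npp.
- apply: assoc_star; apply: assoc_pnp; rewrite ?opprK //; exact: fiber_star.
- by apply: assoc_star; apply: assoc_npp; rewrite ?opprK.
by apply: assoc_star; apply: assoc_ppp.
Qed.

End CornerSystems.

(** * The bundle *)

Section MultiplierFixedPoints.
Context {R : realType} {A : cstarAlgType R}.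
Implicit Types (a : A) (m : multiplier A).

Lemma closed_mulR_fixed m : closed [set a | mulR m a = a].
Proof.
have -> : [set a | mulR m a = a] =
    \bigcap_(y in [set: A]) [set a | a ** mulL m y = a ** y].
  apply/seteqP; split => [a /= ha y _ /=|a /= ha]; first by rewrite mulLR ha.
  by apply: cmul_injr => y; rewrite -mulLR; exact: ha.
apply: closed_bigI => y _.
by apply: closed_equalizer => a; apply: cvg_cmulr; exact: cvg_id.
Qed.

Lemma closed_mulL_fixed m : closed [set a | mulL m a = a].
Proof.
have -> : [set a | mulL m a = a] =
    \bigcap_(y in [set: A]) [set a | mulR m y ** a = y ** a].
  apply/seteqP; split => [a /= ha y _ /=|a /= ha]; first by rewrite -mulLR ha.
  by apply: cmul_injl => y; rewrite mulLR; exact: ha.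
apply: closed_bigI => y _.
by apply: closed_equalizer => a; apply: cvg_cmull; exact: cvg_id.
Qed.

End MultiplierFixedPoints.

Section CornerBundle.
Context {R : realType} {G : zmodType} {A : cstarAlgType R}.
Context {Gpos : set G} {alpha L : G -> A -> A}.
Hypotheses (hG : positive_cone Gpos) (hA : corner_system Gpos alpha L).
Implicit Types (g h k : G) (a b c : A).

Local Notation fib := (corner_fiber Gpos alpha).
Local Notation mul := (corner_mul Gpos alpha L).

Definition fiber_pred g : {pred A} := [pred a | `[< fib g a >]].

Lemma fiber_submod g : GRing.submod_closed (fiber_pred g).
Proof.
have fibP x : x \in fiber_pred g = `[< fib g x >] by [].
have [hg|hg] := cone_total hG g.
  split=> [|k x y]; rewrite !fibP.
    by apply/asboolP/(fiber_pos hG hA _ hg); exact: (linear0_of (@mulR_linear _ _ _)).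
  move=> /asboolP /(fiber_pos hG hA _ hg) fx /asboolP /(fiber_pos hG hA _ hg) fy.
  by apply/asboolP/(fiber_pos hG hA _ hg); rewrite mulR_linear fx fy.
split=> [|k x y]; rewrite !fibP.
  by apply/asboolP/(fiber_neg hG hA _ hg); exact: (linear0_of (@mulL_linear _ _ _)).
move=> /asboolP /(fiber_neg hG hA _ hg) fx /asboolP /(fiber_neg hG hA _ hg) fy.
by apply/asboolP/(fiber_neg hG hA _ hg); rewrite mulL_linear fx fy.
Qed.

Lemma fiber_closed g : closed [set a | a \in fiber_pred g].
Proof.
have [hg|hg] := cone_total hG g.
  rewrite (_ : [set _ | _] = [set a | mulR (corner_proj alpha g) a = a]).
    exact: closed_mulR_fixed.
  apply/seteqP; split => a /=; first by move=> /asboolP /(fiber_pos hG hA _ hg).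
  by move=> ha; apply/asboolP/(fiber_pos hG hA _ hg).
rewrite (_ : [set _ | _] = [set a | mulL (corner_proj alpha (- g)) a = a]).
  exact: closed_mulL_fixed.
apply/seteqP; split => a /=; first by move=> /asboolP /(fiber_neg hG hA _ hg).
by move=> ha; apply/asboolP/(fiber_neg hG hA _ hg).
Qed.

Definition fiber_space g : completeNormedModType R[i] :=
  subspace_space (ClosedSubspace (@fiber_submod g) (@fiber_closed g)).

Definition fiber_coef g (x : fiber_space g) : A := val x.

Definition fiber_elt g a (ha : fib g a) : fiber_space g := exist _ a (asboolT ha).

Lemma fiber_coefP g (x : fiber_space g) : fib g (fiber_coef x).
Proof. exact: (asboolW (valP x)). Qed.

Lemma fiber_coef_inj g : injective (@fiber_coef g).
Proof. exact: val_inj. Qed.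

(** Elements of the total space are compared through degree and coefficient. *)
Lemma fell_elt_eq g h (x : fiber_space g) (y : fiber_space h) :
  g = h -> fiber_coef x = fiber_coef y ->
  fell_elt (B := fiber_space) x = fell_elt (B := fiber_space) y.
Proof. by move=> e; case: _ / e y => y /fiber_coef_inj ->. Qed.

Definition bundle_mul g h (x : fiber_space g) (y : fiber_space h) :
  fiber_space (g + h) :=
  fiber_elt (fiber_mul hG hA (fiber_coefP x) (fiber_coefP y)).

Definition bundle_star g (x : fiber_space g) : fiber_space (- g) :=
  fiber_elt (fiber_star hG hA (fiber_coefP x)).

Definition corner_bundle : fellBundle R G.
Proof.
refine (@FellBundle R G fiber_space bundle_mul bundle_star _ _ _ _ _ _ _ _ _ _ _).
- move=> g h y k x x'; apply: fiber_coef_inj; exact: (mul_linearl hG hA).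
- move=> g h x k y y'; apply: fiber_coef_inj; exact: (mul_linearr hG hA).
- move=> g h k x y z; apply: fell_elt_eq; first by rewrite addrA.
  by apply: (mul_assoc hG hA); exact: fiber_coefP.
- by move=> g x y; apply: fiber_coef_inj; exact: starD.
- by move=> g k x; apply: fiber_coef_inj; exact: starZ.
- by move=> g x; exact: norm_star.
- move=> g h x y; apply: fell_elt_eq; first by rewrite opprD addrC.
  exact: (mul_star hG hA).
- by move=> g x; apply: fell_elt_eq; [exact: opprK|exact: starK].
- by move=> g h x y; exact: (mul_norm hG hA).
- by move=> g x; case: (mul_cstar_pos hG hA (fiber_coefP x)).
move=> g x; have [[c xc] _] := mul_cstar_pos hG hA (fiber_coefP x).
have c0 : fib 0 c by apply/(fiber_pos hG hA _ (cone0 hG)); case: (proj0 hG hA c).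
exists (fiber_elt c0); apply: fell_elt_eq; first by rewrite !addNr.
have e : mul (- 0) 0 (star c) c = star c ** c.
  by rewrite oppr0 mul_pp ?(corner_alpha0 hA) //; exact: (cone0 hG).
by rewrite [LHS]/fiber_coef /= xc -e.
Defined.

End CornerBundle.

Theorem proposition8p6 (R : realType) (G : zmodType) (Gpos : set G)
    (A : cstarAlgType R) (alpha L : G -> A -> A)
    (hG : positive_cone Gpos) (hA : corner_system Gpos alpha L) :
  exists (B : fellBundle R G) (coef : forall g : G, B g -> A),
    [/\ forall g : G, linear (coef g),
        forall (g : G) (b : B g), `|coef g b| = `|b|,
        forall g : G, range (coef g) = corner_fiber Gpos alpha g,
        forall (g : G) (b : B g), coef (- g) (fstar B b) = star (coef g b)
      & forall (g h : G) (b : B g) (c : B h),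
          coef (g + h) (fmul B b c) =
          corner_mul Gpos alpha L g h (coef g b) (coef h c)].
Proof.
exists (corner_bundle hG hA), (@fiber_coef _ _ _ _ _ _ hG hA); split=> //.
move=> g; apply/seteqP; split=> [_ [x _ <-]|a ha]; first exact: fiber_coefP.
by exists (fiber_elt hG hA ha).
Qed.
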